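(* Consider the state-dependent DMC with noncausal CSI at the transmitter described in the context. For every $R_K\geq 0$ and $B\geq 0$, the covert capacity with noncausal CSI satisfies $$C_{\mathrm{nc}}\leq \max\big(I(U;Y)-I(U;S)\big),$$ where the maximum is over conditional PMFs $P_{U|S}$ on a finite set $\mathcal{U}$ with $|\mathcal{U}|\leq \min\{|\mathcal{X}|+|\mathcal{Y}|+|\mathcal{Z}|+|\mathcal{S}|-3,\ |\mathcal{X}|\cdot|\mathcal{S}|\}$ and functions $x:\mathcal{U}\times\mathcal{S}\to\mathcal{X}$, evaluated under the joint distribution $P_S(s)P_{U|S}(u|s)\mathbbm{1}\{x=x(u,s)\}P_{Y,Z|S,X}(y,z|s,x)$, subject to $P_Z=Q_0$ and $\mathrm{E}[b(X)]\leq B$.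
   Context: A state-dependent discrete memoryless channel consists of finite alphabets $\mathcal{X}$ (input), $\mathcal{S}$ (state), $\mathcal{Y}$ (receiver output), $\mathcal{Z}$ (warden output), a state PMF $P_S$, and a channel law $P_{Y,Z|S,X}$. Over $n$ uses, the state sequence $S^n$ is IID $\sim P_S$, and given $(X^n,S^n)$ the pairs $(Y_i,Z_i)$ are conditionally independent with law $P_{Y,Z|S,X}(\cdot,\cdot|S_i,X_i)$. A designated ''no input'' symbol $x_0\in\mathcal{X}$ is fixed, and $Q_0(z)=\sum_{s}P_S(s)P_{Z|S,X}(z|s,x_0)$; $Q_0^{\times n}$ is its $n$-fold product. It is assumed that $\mathrm{supp}(Q_0)=\mathcal{Z}$. A cost function $b:\mathcal{X}\to[0,\infty)$ is given, with $b(x^n)=\frac1n\sum_{i=1}^n b(x_i)$. A secret key $K$ uniform on $[1:2^{nR_K}]$ and a message $M$ uniform on $[1:2^{nR}]$ are mutually independent and independent of $S^n$; $K$ is known to transmitter and receiver, while $S^n$ is known only to the transmitter. With causal CSI, an $(2^{nR},2^{nR_K},n)$ code consists of an encoder producing $X_i$ as a function of $(M,K,S^i)$ (and possibly private randomness of the transmitter independent of $(M,K,S^n)$), $i\in[1:n]$, and a decoder mapping $(Y^n,K)$ to $\hat M$. With noncausal CSI, the encoder produces $X^n$ from $(M,K,S^n)$ (and possibly such private randomness). $P_e^{(n)}=P(\hat M\neq M)$, and $\widehat{P}_{Z^n}$ is the distribution of the warden's output $Z^n$ induced by the code. A rate $R$ is achievable (for given $R_K,B$) if there is a sequence of codes with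 $\limsup_{n}\mathrm{E}[b(X^n)]\leq B$, $P_e^{(n)}\to 0$, and $D(\widehat{P}_{Z^n}\|Q_0^{\times n})\to 0$. The covert capacity $C_{\mathrm{c}}$ (causal CSI) resp. $C_{\mathrm{nc}}$ (noncausal CSI) is the supremum of achievable rates. *)

(* Defs.v *)
From mathcomp Require Import all_boot.
From Stdlib Require Import Reals.

Set Implicit Arguments.
Unset Strict Implicit.
Unset Printing Implicit Defensive.

Local Open Scope R_scope.

Definition sumR (T : finType) (f : T -> R) : R := \big[Rplus/0]_(t : T) f t.
Definition prodR (n : nat) (f : 'I_n -> R) : R := \big[Rmult/1]_(i < n) f i.

Definition log2 (x : R) : R := ln x / ln 2.

Definition is_pmf (T : finType) (p : T -> R) : Prop :=
  (forall t, 0 <= p t) /\ sumR p = 1.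

(* channel W s x y z = P_{Y,Z|S,X}(y,z|s,x); marginals *)
Section Channel.
Variables (S X Y Z : finType).

Definition WY (W : S -> X -> Y -> Z -> R) s x y : R := sumR (fun z => W s x y z).
Definition WZ (W : S -> X -> Y -> Z -> R) s x z : R := sumR (fun y => W s x y z).

Definition Q0 (PS : S -> R) (W : S -> X -> Y -> Z -> R) (x0 : X) (z : Z) : R :=
  sumR (fun s => PS s * WZ W s x0 z).

Definition Q0n (PS : S -> R) (W : S -> X -> Y -> Z -> R) (x0 : X) (n : nat)
  (zn : {ffun 'I_n -> Z}) : R := prodR (fun i => Q0 PS W x0 (zn i)).
End Channel.

Definition msize (r : R) (n : nat) : nat := Z.to_nat (Int_part (Rpower 2 (INR n * r))).

(* Relative entropy (nats); ln 0 = 0 in Stdlib, so 0 * ln(..) = 0 *)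
Definition KL (T : finType) (p q : T -> R) : R := sumR (fun t => p t * ln (p t / q t)).

Definition MI (A B : finType) (p : A -> B -> R) : R :=
  sumR (fun a => sumR (fun b => p a b *
     log2 (p a b / (sumR (fun b' => p a b') * sumR (fun a' => p a' b))))).

(* A (2^{nR}, 2^{nR_K}, n) code with noncausal CSI: stochastic encoder
   (private randomness) P(x^n | m, k, s^n), deterministic decoder (y^n, k) -> m. *)
Record nc_code (S X Y : finType) (n Mn Kn : nat) := NcCode {
  enc : 'I_Mn -> 'I_Kn -> {ffun 'I_n -> S} -> {ffun 'I_n -> X} -> R;
  enc_pmf : forall m k s, is_pmf (enc m k s);
  dec : {ffun 'I_n -> Y} -> 'I_Kn -> 'I_Mn }.

Section Code.
Variables (S X Y Z : finType) (PS : S -> R) (W : S -> X -> Y -> Z -> R).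
Variables (n Mn Kn : nat) (C : nc_code S X Y n Mn Kn).

Definition cweight (m : 'I_Mn) (k : 'I_Kn) (s : {ffun 'I_n -> S}) (x : {ffun 'I_n -> X}) : R :=
  / INR Mn * / INR Kn * prodR (fun i => PS (s i)) * enc C m k s x.

Definition Pe : R :=
  sumR (fun m => sumR (fun k => sumR (fun s => sumR (fun x => sumR (fun y : {ffun 'I_n -> Y} =>
    cweight m k s x * prodR (fun i => WY W (s i) (x i) (y i)) *
    (if dec C y k == m then 0 else 1)))))).

Definition PZhat (z : {ffun 'I_n -> Z}) : R :=
  sumR (fun m => sumR (fun k => sumR (fun s => sumR (fun x =>
    cweight m k s x * prodR (fun i => WZ W (s i) (x i) (z i)))))).

Definition Ecost (b : X -> R) : R :=
  sumR (fun m => sumR (fun k => sumR (fun s => sumR (fun x =>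
    cweight m k s x * (sumR (fun i : 'I_n => b (x i)) / INR n))))).
End Code.

Definition achievable_nc (S X Y Z : finType) (PS : S -> R) (W : S -> X -> Y -> Z -> R)
  (x0 : X) (b : X -> R) (RK B r : R) : Prop :=
  0 <= r /\
  exists codes : forall n : nat, nc_code S X Y n (msize r n) (msize RK n),
    (forall eps, 0 < eps -> exists N, forall n, (N <= n)%coq_nat ->
        Ecost PS (codes n) b <= B + eps) /\
    Un_cv (fun n => Pe PS W (codes n)) 0 /\
    Un_cv (fun n => KL (PZhat PS W (codes n)) (Q0n PS W x0 (n:=n))) 0.

Definition nc_feasible (S X Y Z U : finType) (PS : S -> R) (W : S -> X -> Y -> Z -> R)
  (x0 : X) (b : X -> R) (B : R) (PUS : S -> U -> R) (xf : U -> S -> X) : Prop :=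
  (forall s, is_pmf (PUS s)) /\
  (forall z, sumR (fun s => sumR (fun u => PS s * PUS s u * WZ W s (xf u s) z))
             = Q0 PS W x0 z) /\
  sumR (fun s => sumR (fun u => PS s * PUS s u * b (xf u s))) <= B.

Definition nc_value (S X Y Z U : finType) (PS : S -> R) (W : S -> X -> Y -> Z -> R)
  (PUS : S -> U -> R) (xf : U -> S -> X) : R :=
  MI (fun (u : U) (y : Y) => sumR (fun s => PS s * PUS s u * WY W s (xf u s) y))
  - MI (fun (u : U) (s : S) => PS s * PUS s u).

(* Main.v *)
Require Import Defs.
From Stdlib Require Import ZArith Reals.
From mathcomp Require Import all_boot all_order all_algebra.
From mathcomp Require Import boolp Rstruct.
From mathcomp Require Import ring lra zify.

(** For a code of length n put U_i = (M, K, Y^{i-1}, S_{i+1}^n).  With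
    G_i = (M, K, Y^{i-1}, S_i^n), the pairs (U_i, S_i) and (U_i, Y_i) are
    rearrangements of G_i and G_{i+1}, so the sum of I(U_i; Y_i) - I(U_i; S_i)
    telescopes and, with Fano's inequality, is at least
    (1 - Pe) ln |M| - ln 2.  Time sharing over i, and replacing the stochastic
    dependence of X on (U, S) by a random strategy S -> X, give a single-letter
    auxiliary variable.  Its support is reduced by moving along linear
    dependencies of the constraints in a direction that does not decrease the
    objective.  As the output of the warden has total variation distance o(1)
    from the product law, so have its letters from Q_0; a limit point of these
    auxiliary variables, on an alphabet of fixed size, is the one required. *)

Set Implicit Arguments.
Unset Strict Implicit.
Unset Printing Implicit Defensive.

Import Order.TTheory GRing.Theory Num.Theory.
Local Open Scope ring_scope.
(* Otherwise the numerals in arguments of type R would be those of R_scope. *)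
Bind Scope ring_scope with R.
Arguments ln x%_ring_scope.

(** * Entropy *)

(** An auxiliary variable is handled throughout as a family of unnormalised masses [D t s x] of (U,
    S, X), with P(U = t) kept inside. The law of S, the law of Z and the cost are then linear in
    [D], the entropy of U cancels in I(U;Y) - I(U;S), and no conditional law has to be controlled
    for letters whose probability vanishes in the limit.

    The obstacle is that a code meets P_Z = Q_0 and the cost bound only approximately, so a limit is
    unavoidable, and compactness needs an alphabet whose size does not depend on n. The randomness
    of X given (U, S) must therefore be removed, and the support reduced, before the limit is taken.
    Random strategies enlarge the alphabet, but the reduction merely rescales slices [D t], so X
    stays a function of (U, S).

    The rate of the key is unrestricted because the same ln |K| occurs in H(M, K, S^n) and in the
    upper bound on H(M, K, Y^n). *)

Lemma sumr_pair (A B : finType) (F : A * B -> R) :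
  \sum_w F w = \sum_a \sum_b F (a, b).
Proof. by rewrite pair_bigA; apply: eq_bigr => -[]. Qed.

Lemma sumr_gt0_neq0 (A : finType) (F : A -> R) :
  (forall a, 0 <= F a) -> 0 < \sum_a F a -> exists a, 0 < F a.
Proof.
move=> F0 h; apply/existsP; rewrite -[X in is_true X]negbK negb_exists.
apply/negP => /forallP Fn; move: h; rewrite big1 ?ltxx// => a _.
by apply/eqP; rewrite eq_le F0 andbT leNgt Fn.
Qed.

Lemma ler_sumr_term (A : finType) (F : A -> R) a :
  (forall b, 0 <= F b) -> F a <= \sum_b F b.
Proof.
by move=> F0; rewrite (bigD1 a)//= lerDl; apply: sumr_ge0.
Qed.

Lemma lnM (x y : R) : 0 < x -> 0 < y -> ln (x * y) = ln x + ln y.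
Proof. by move=> /RltP x0 /RltP y0; exact: ln_mult. Qed.

Lemma lnV (x : R) : 0 < x -> ln x^-1 = - ln x.
Proof. by move=> /RltP x0; exact: ln_Rinv. Qed.

Lemma ln1 : ln 1 = 0.
Proof. exact: ln_1. Qed.

Lemma ln2_gt0 : 0 < ln 2.
Proof.
by rewrite -ln1; apply/RltP/ln_increasing; apply/RltP; [exact: ltr01|lra].
Qed.

Lemma ln_le_sub1 (x : R) : 0 < x -> ln x <= x - 1.
Proof.
move=> x0; have /RleP := exp_ineq1_le (ln x).
by rewrite exp_ln; [rewrite RplusE R1E; lra|apply/RltP].
Qed.

Lemma ler_ln (x y : R) : 0 < x -> x <= y -> ln x <= ln y.
Proof.
move=> x0; rewrite le_eqVlt => /predU1P[->//|xy]; apply/ltW/RltP.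
by apply: ln_increasing; apply/RltP.
Qed.

Lemma ln_prod (I : finType) (F : I -> R) :
  (forall i, 0 < F i) -> ln (\prod_i F i) = \sum_i ln (F i).
Proof.
move=> F0; suff : 0 < \prod_i F i /\ ln (\prod_i F i) = \sum_i ln (F i) by case.
apply: (big_ind2 (fun p s => 0 < p /\ ln p = s)); first by rewrite ln1.
- by move=> p s p' s' [p0 <-] [p'0 <-]; split; [exact: mulr_gt0|rewrite lnM].
- by move=> i _.
Qed.

Definition eta (t : R) : R := - (t * ln t).

Lemma eta0 : eta 0 = 0.
Proof. by rewrite /eta mul0r oppr0. Qed.

(** Concavity: the right-hand side is the tangent of [eta] at [a]. The last hypothesis excludes a =
    0 < t, where the convention ln 0 = 0 would make the bound false. *)
Lemma eta_tangent (t a : R) : 0 <= t -> 0 <= a -> (0 < t -> 0 < a) ->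
  eta t <= - (t * ln a) + a - t.
Proof.
rewrite le_eqVlt => /predU1P[<- a0 _|t0 _ /(_ t0) a0].
  by rewrite eta0 mul0r oppr0 add0r addr0.
have : ln (a / t) <= a / t - 1 by apply: ln_le_sub1; rewrite divr_gt0.
have ta : t * (a / t) = a by rewrite mulrC divfK ?gt_eqF.
by rewrite lnM ?invr_gt0// lnV// -(ler_pM2l t0) !mulrBr ta /eta; lra.
Qed.

Lemma gibbs (A : finType) (p q : A -> R) :
  (forall a, 0 <= p a) -> (forall a, 0 <= q a) ->
  (forall a, 0 < p a -> 0 < q a) -> \sum_a q a <= \sum_a p a ->
  \sum_a eta (p a) <= - \sum_a p a * ln (q a).
Proof.
move=> p0 q0 pq s.
have : \sum_a eta (p a) <= \sum_a (q a - p a - p a * ln (q a)).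
  apply: ler_sum => a _; rewrite addrC addrA.
  by apply: eta_tangent => //; exact: pq.
rewrite !sumrB; lra.
Qed.

Lemma eta_jensen (I : finType) (w q : I -> R) :
  (forall i, 0 <= w i) -> \sum_i w i = 1 -> (forall i, 0 <= q i) ->
  \sum_i w i * eta (q i) <= eta (\sum_i w i * q i).
Proof.
move=> w0 w1 q0; set a := \sum_i w i * q i.
have a0 : 0 <= a by apply: sumr_ge0 => i _; exact: mulr_ge0.
apply: (@le_trans _ _ (\sum_i (w i * a - w i * q i - w i * q i * ln a))).
  apply: ler_sum => i _; have [->|wi] := eqVneq (w i) 0.
    by rewrite !mul0r !subrr.
  have wi0 : 0 < w i by rewrite lt_def wi w0.
  have : eta (q i) <= - (q i * ln a) + a - q i.
    apply: eta_tangent => // qi0; apply: (@lt_le_trans _ _ (w i * q i)).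
      exact: mulr_gt0.
    by apply: (ler_sumr_term (F := fun i => w i * q i)) => j; exact: mulr_ge0.
  rewrite -(ler_pM2l wi0); nra.
by rewrite !sumrB -!mulr_suml w1 -/a /eta; lra.
Qed.

Lemma etaZ (c t : R) : 0 <= c -> 0 <= t -> eta (c * t) = c * eta t - t * (c * ln c).
Proof.
rewrite le_eqVlt => /predU1P[<- _|c0]; first by rewrite !mul0r eta0 mulr0 subr0.
rewrite le_eqVlt => /predU1P[<-|t0]; first by rewrite !(mulr0, mul0r) eta0 mulr0 subr0.
by rewrite /eta lnM//; ring.
Qed.

Section Entropy.
Variables (Om : finType) (P : Om -> R).

Definition law (A : eqType) (f : Om -> A) (a : A) : R := \sum_(w | f w == a) P w.

(* Averaging over the sample space makes the entropy depend on f only through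
   the partition it induces. *)
Definition ent (A : eqType) (f : Om -> A) : R := - \sum_w P w * ln (law f (f w)).

Lemma sum_law (A : finType) (f : Om -> A) (F : A -> R) :
  \sum_w P w * F (f w) = \sum_a law f a * F a.
Proof.
rewrite (partition_big f xpredT)//=; apply: eq_bigr => a _.
by rewrite /law mulr_suml; apply: eq_bigr => w /eqP ->.
Qed.

Lemma sum_law1 (A : finType) (f : Om -> A) : \sum_a law f a = \sum_w P w.
Proof. by rewrite [RHS](partition_big f xpredT). Qed.

Lemma ent_law (A : finType) (f : Om -> A) : ent f = \sum_a eta (law f a).
Proof. by rewrite /ent (sum_law f (fun a => ln (law f a))) /eta sumrN. Qed.

Lemma ent_eq (A B : eqType) (f : Om -> A) (g : Om -> B) :
  (forall w w', (f w == f w') = (g w == g w')) -> ent f = ent g.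
Proof.
move=> fg; congr (- _); apply: eq_bigr => w _; congr (_ * ln _).
by apply: eq_bigl => w'.
Qed.

Hypothesis P0 : forall w, 0 <= P w.

Lemma law_ge0 (A : eqType) (f : Om -> A) a : 0 <= law f a.
Proof. by apply: sumr_ge0. Qed.

Lemma law_ge (A : eqType) (f : Om -> A) w : P w <= law f (f w).
Proof. by rewrite /law (bigD1 w)//= lerDl sumr_ge0. Qed.

Lemma law_gt0 (A : finType) (f : Om -> A) a :
  0 < law f a -> exists2 w, f w = a & 0 < P w.
Proof.
rewrite /law big_mkcond/= => /sumr_gt0_neq0[w|w].
  by case: ifP.
by case: eqP => [fw Pw|_]; [exists w|rewrite ltxx].
Qed.

Lemma ent_gibbs (A : finType) (f : Om -> A) (q : A -> R) :
  (forall a, 0 <= q a) -> (forall w, 0 < P w -> 0 < q (f w)) ->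
  \sum_a q a <= \sum_w P w -> ent f <= - \sum_w P w * ln (q (f w)).
Proof.
move=> q0 Pq s; rewrite ent_law (sum_law f (fun a => ln (q a))).
apply: gibbs => //; [exact: law_ge0| |by rewrite sum_law1].
by move=> a /law_gt0[w <-]; exact: Pq.
Qed.

End Entropy.

(** * Independence of one coordinate under a product law *)

Section Resample.
Variables (I Y : finType) (V : I -> Y -> R).
Hypothesis V1 : forall j, \sum_b V j b = 1.

Lemma sum_prod_pmf : \sum_(y : {ffun I -> Y}) \prod_j V j (y j) = 1.
Proof.
by rewrite -(bigA_distr_bigA (fun j b => V j b)) big1 // => j _; rewrite V1.
Qed.

(** Under a product law, coordinate i is independent of any event [Q] that ignores it. This is the
    form in which the memorylessness of the channel is used. *)
Lemma resample (Q : pred {ffun I -> Y}) i b :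
  (forall y y' : {ffun I -> Y}, (forall j, j != i -> y j = y' j) -> Q y = Q y') ->
  \sum_(y : {ffun I -> Y} | Q y && (y i == b)) \prod_j V j (y j)
  = V i b * \sum_(y : {ffun I -> Y} | Q y) \prod_j V j (y j).
Proof.
move=> Qi.
pose rho b' := \sum_(y : {ffun I -> Y} | Q y && (y i == b')) \prod_(j | j != i) V j (y j).
have step b' : \sum_(y : {ffun I -> Y} | Q y && (y i == b')) \prod_j V j (y j)
    = V i b' * rho b'.
  rewrite /rho mulr_sumr; apply: eq_bigr => y /andP[_ /eqP <-].
  by rewrite (bigD1 i).
have rhoE b' : rho b' = rho b.
  rewrite /rho.
  (* Overwriting coordinate i by [c] is a bijection between the slices y i = b and y i = b', and
     leaves the product over the other coordinates unchanged. *)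
  pose u c (y : {ffun I -> Y}) := [ffun j => if j == i then c else y j].
  rewrite (reindex_onto (u b') (u b)) /=; last first.
    move=> y /andP[_ /eqP yb]; apply/ffunP => j; rewrite !ffunE.
    by case: eqP => // ->.
  apply: eq_big => [y|y _]; last first.
    by apply: eq_bigr => j /negbTE ji; rewrite ffunE ji.
  have -> : Q (u b' y) = Q y by apply: Qi => j /negbTE ji; rewrite ffunE ji.
  rewrite ffunE eqxx eqxx andbT; congr andb; apply/eqP/eqP => [<-|yb].
    by rewrite ffunE eqxx.
  by apply/ffunP => j; rewrite !ffunE; case: eqP => // ->.
rewrite step; congr (_ * _).
rewrite (partition_big (fun y : {ffun I -> Y} => y i) xpredT)//=.
under eq_bigr do rewrite step rhoE.
by rewrite -mulr_suml V1 mul1r.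
Qed.

End Resample.

(** * Auxiliary schemes *)

Section LinearProgram.
Variables (T J : finType) (v : T -> J -> R) (f : T -> R) (c : J -> R).

Lemma linear_dependency (A : {set T}) : (#|J| < #|A|)%N ->
  exists k : T -> R, [/\ forall u, u \notin A -> k u = 0, exists u, k u != 0
    & forall j, \sum_u k u * v u j = 0].
Proof.
move=> JA; pose M := \matrix_(i < #|A|, j < #|J|) v (enum_val i) (enum_val j).
have : kermx M != 0.
  rewrite kermx_eq0 /row_free neq_ltn; apply/orP; left.
  exact: leq_ltn_trans (rank_leq_col M) JA.
move=> /rowV0Pn[r /sub_kermxP rM r0].
pose k u := \sum_(i | enum_val i == u) r 0 i.
have kE i : k (enum_val i) = r 0 i.
  rewrite /k (bigD1 i)//= big1 ?addr0// => i' /andP[/eqP /enum_val_inj -> ].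
  by rewrite eqxx.
exists k; split.
- move=> u uA; rewrite /k big1// => i /eqP iu.
  by move: uA; rewrite -iu enum_valP.
- have [i ri] : exists i, r 0 i != 0.
    apply/existsP; rewrite -[X in is_true X]negbK negb_exists; apply/negP => /forallP r'.
    case/eqP: r0; apply/rowP => i; rewrite mxE.
    by apply/eqP; move: (r' i); rewrite negbK.
  by exists (enum_val i); rewrite kE.
- move=> j; have := congr1 (fun m : 'rV_#|J| => m 0 (enum_rank j)) rM.
  rewrite !mxE => rMj; rewrite -[RHS]rMj.
  under [RHS]eq_bigr do rewrite mxE enum_rankK.
  rewrite [RHS](partition_big (fun i => enum_val i) xpredT)//=.
  apply: eq_bigr => u _; rewrite /k mulr_suml.
  by apply: eq_bigr => i /eqP ->.
Qed.

(* Moving the weights along a linear dependency, in the direction in which the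
   objective does not decrease, until one of them vanishes keeps all J
   constraints; the objective itself therefore costs no extra atom. *)
Lemma sparse_weights (w : T -> R) :
  (forall u, 0 <= w u) -> (forall u, 0 < w u -> 0 < \sum_j c j * v u j) ->
  exists w' : T -> R, [/\ forall u, 0 <= w' u, (#|[set u | w' u != 0%R]| <= #|J|)%N,
    forall j, \sum_u w' u * v u j = \sum_u w u * v u j
    & \sum_u w u * f u <= \sum_u w' u * f u].
Proof.
have [m] := ubnP #|[set u | w u != 0]|; elim: m w => // m IH w wm w0 wt.
have [JA|JA] := leqP #|[set u | w u != 0]| #|J|; first by exists w.
have [k [[kA k0 kv] kf]] : exists k : T -> R, [/\ forall u, w u = 0 -> k u = 0, exists u, k u != 0
    & (forall j, \sum_u k u * v u j = 0)] /\ 0 <= \sum_u k u * f u.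
  have [k [kA [u ku] kv]] := linear_dependency JA.
  have kA' u' : w u' = 0 -> k u' = 0 by move=> h; apply: kA; rewrite inE h eqxx.
  have [kf|/ltW kf] := leP 0 (\sum_u k u * f u).
    by exists k; split=> //; split => //; exists u.
  exists (fun u => - k u); split; last first.
    by under eq_bigr do rewrite mulNr; rewrite sumrN oppr_ge0.
  split; first by move=> u' /kA' ->; rewrite oppr0.
    by exists u; rewrite oppr_eq0.
  by move=> j; under eq_bigr do rewrite mulNr; rewrite sumrN kv oppr0.
(* This combination of the constraints is positive wherever [w] is, and [k] annihilates it; so the
   nonzero [k], supported where [w] is, must be negative somewhere. *)
pose t u := \sum_j c j * v u j.
have kt : \sum_u k u * t u = 0.
  under eq_bigr do rewrite /t mulr_sumr.
  rewrite exchange_big big1//= => j _.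
  by under eq_bigr do rewrite mulrCA; rewrite -mulr_sumr kv mulr0.
have [u0 ku0] : exists u, k u < 0.
  apply/existsP; rewrite -[X in is_true X]negbK negb_exists; apply/negP => /forallP kn.
  have kge u : 0 <= k u by rewrite leNgt.
  case: k0 => u ku.
  have ku' : 0 < k u by rewrite lt_def ku kge.
  have wu : 0 < w u by rewrite lt_def w0 andbT; apply: contra_neq ku; exact: kA.
  have ktge u' : 0 <= k u' * t u'.
    have [->|ku'0] := eqVneq (k u') 0; first by rewrite mul0r.
    apply: mulr_ge0 => //; apply/ltW/wt; rewrite lt_def w0 andbT.
    by apply: contra_neq ku'0; exact: kA.
  have := ler_sumr_term u ktge; rewrite kt leNgt mulr_gt0//.
  exact: wt.
case: (@arg_minP _ _ _ u0 (fun u => k u < 0) (fun u => w u / - k u) ku0) => u1 ku1 min1.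
(* The ratio test of the simplex method: the largest step that keeps all weights nonnegative, at
   which the weight of [u1] vanishes. *)
set th := w u1 / - k u1 in min1.
have th0 : 0 <= th by rewrite divr_ge0// oppr_ge0 ltW.
pose w' u := w u + th * k u.
have w'0 u : 0 <= w' u.
  rewrite /w'; have [ku|ku] := leP 0 (k u); first by rewrite addr_ge0// mulr_ge0.
  have := min1 u ku; rewrite ler_pdivlMr ?oppr_gt0//; lra.
have w'u1 : w' u1 = 0.
  by rewrite /w' /th invrN mulrN mulNr divfK ?subrr// lt_eqF.
have w's u : w' u != 0 -> w u != 0.
  by apply: contra_neq => wu; rewrite /w' wu (kA _ wu) mulr0 addr0.
have wu1 : w u1 != 0.
  by apply: contraTneq ku1 => /kA ->; rewrite ltxx.
have sub : [set u | w' u != 0] \proper [set u | w u != 0].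
  apply/properP; split; first by apply/subsetP => u; rewrite !inE; exact: w's.
  by exists u1; rewrite !inE ?w'u1 ?eqxx.
have [||u|w'' [w''0 w''J w''v w''f]] := IH w'.
- exact: leq_trans (proper_card sub) _.
- exact: w'0.
- rewrite lt_def => /andP[/w's wu _]; apply: wt.
  by rewrite lt_def wu w0.
have addw (g : T -> R) : \sum_u w' u * g u = \sum_u w u * g u + th * \sum_u k u * g u.
  rewrite mulr_sumr -big_split; apply: eq_bigr => u _ /=; rewrite /w'; ring.
exists w''; split=> //.
- by move=> j; rewrite w''v addw kv mulr0 addr0.
- by apply: le_trans w''f; rewrite addw lerDl mulr_ge0.
Qed.

End LinearProgram.

(** Relabels a support of at most N atoms by ['I_N], padding with zeros, so that supports of
    different sizes share one alphabet. *)
Lemma sum_enum_val_insub (T : finType) (A : {set T}) N (F : T -> R) :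
  (#|A| <= N)%N -> (forall u, u \notin A -> F u = 0) ->
  \sum_(k < N) oapp (fun i : 'I_#|A| => F (enum_val i)) 0 (insub (val k)) = \sum_u F u.
Proof.
move=> AN FA; rewrite [RHS](bigID (mem A))/= [X in _ + X]big1 ?addr0; last exact: FA.
rewrite [RHS]big_enum_val.
pose G (k : nat) := oapp (fun i : 'I_#|A| => F (enum_val i)) 0 (insub k).
rewrite -[LHS]/(\sum_(k < N) G k).
have -> : \sum_(i < #|A|) F (enum_val i) = \sum_(i < #|A|) G i.
  by apply: eq_bigr => i _; rewrite /G valK.
rewrite (big_ord_widen _ G AN) [RHS]big_mkcond; apply: eq_bigr => k _.
by case: ifP => // kA; rewrite /G insubF.
Qed.

(** * Linear functionals and the objective on unnormalised masses *)

Section Schemes.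
Variables (S X Y : finType) (V : S -> X -> Y -> R).
Hypothesis V0 : forall s x y, 0 <= V s x y.
Hypothesis V1 : forall s x, \sum_y V s x y = 1.

Definition lin (a d : S -> X -> R) : R := \sum_s \sum_x d s x * a s x.

(* For d the joint mass of (S, X) on the event U = u, this is
   P(U = u) (H(S | U = u) - H(Y | U = u)) in nats; so summing phi over u and
   subtracting phi of the total mass gives I(U; Y) - I(U; S). *)
Definition phi (d : S -> X -> R) : R :=
  \sum_s eta (\sum_x d s x) - \sum_y eta (lin (fun s x => V s x y) d).

(* X is a function of (U, S); in this form the condition passes to limits. *)
Definition deterministic (T : Type) (D : T -> S -> X -> R) : Prop :=
  forall t s x x', x != x' -> D t s x * D t s x' = 0.

Lemma lin_ge0 (a d : S -> X -> R) :
  (forall s x, 0 <= a s x) -> (forall s x, 0 <= d s x) -> 0 <= lin a d.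
Proof. by move=> a0 d0; do 2![apply: sumr_ge0 => ? _]; exact: mulr_ge0. Qed.

Lemma linZ (a d : S -> X -> R) w : lin a (fun s x => w * d s x) = w * lin a d.
Proof.
rewrite /lin mulr_sumr; apply: eq_bigr => s _.
by rewrite mulr_sumr; apply: eq_bigr => x _; rewrite mulrA.
Qed.

Lemma lin_sum (T : finType) (a : S -> X -> R) (D : T -> S -> X -> R) :
  lin a (fun s x => \sum_t D t s x) = \sum_t lin a (D t).
Proof.
rewrite /lin [RHS]exchange_big; apply: eq_bigr => s _ /=.
rewrite [RHS]exchange_big; apply: eq_bigr => x _ /=.
by rewrite mulr_suml.
Qed.

Lemma eq_lin (a d d' : S -> X -> R) : (forall s x, d s x = d' s x) -> lin a d = lin a d'.
Proof. by move=> dd; do 2![apply: eq_bigr => ? _]; rewrite dd. Qed.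

Lemma eq_phi (d d' : S -> X -> R) : (forall s x, d s x = d' s x) -> phi d = phi d'.
Proof.
move=> dd; congr (_ - _).
  by apply: eq_bigr => s _; congr eta; apply: eq_bigr => x _.
by apply: eq_bigr => y _; rewrite (eq_lin _ dd).
Qed.

Lemma sum_lin_pmf (d : S -> X -> R) :
  \sum_y lin (fun s x => V s x y) d = \sum_s \sum_x d s x.
Proof.
rewrite /lin exchange_big; apply: eq_bigr => s _ /=.
rewrite exchange_big; apply: eq_bigr => x _ /=.
by rewrite -mulr_sumr V1 mulr1.
Qed.

(** By [etaZ] each entropy sum is homogeneous up to w ln w times its total mass; the state and
    output marginals have the same total mass, so the corrections cancel. *)
Lemma phiZ (d : S -> X -> R) w : 0 <= w -> (forall s x, 0 <= d s x) ->
  phi (fun s x => w * d s x) = w * phi d.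
Proof.
move=> w0 d0; rewrite /phi.
under eq_bigr do rewrite -mulr_sumr etaZ ?sumr_ge0//.
under [X in _ - X]eq_bigr do rewrite linZ etaZ ?lin_ge0//.
rewrite !sumrB -!mulr_sumr -!mulr_suml sum_lin_pmf; ring.
Qed.

Lemma phi0 : phi (fun _ _ => 0) = 0.
Proof.
rewrite -[RHS](mul0r (phi (fun _ _ => 0))) -phiZ//; apply: eq_phi => s x.
by rewrite mulr0.
Qed.

(* The strategies f : S -> X are drawn independently of S with the prescribed
   conditional marginals; concavity of eta takes care of H(Y | U). *)
Lemma functional_representation (x0 : X) (T : finType) (D : T -> S -> X -> R) :
  (forall t s x, 0 <= D t s x) ->
  exists D' : T * {ffun S -> X} -> S -> X -> R,
    [/\ forall t s x, 0 <= D' t s x, deterministic D',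
       forall s x, \sum_t D' t s x = \sum_t D t s x
     & \sum_t phi (D t) <= \sum_t phi (D' t)].
Proof.
move=> D0; pose p t s := \sum_x D t s x.
have p0 t s : 0 <= p t s by apply: sumr_ge0.
(* Where (t, s) has no mass, the point mass at [x0] keeps [ka t s] a PMF, so that the product [pi t]
   is one as well. *)
pose ka t s x := if p t s == 0 then (x == x0)%:R else D t s x / p t s.
have ka0 t s x : 0 <= ka t s x.
  by rewrite /ka; case: ifP => _; [exact: ler0n|exact: divr_ge0].
have ka1 t s : \sum_x ka t s x = 1.
  rewrite /ka; case: (eqVneq (p t s) 0) => [_|ps]; last by rewrite -mulr_suml divff.
  by rewrite (bigD1 x0)//= eqxx big1 ?addr0// => x /negbTE ->.
have pka t s x : p t s * ka t s x = D t s x.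
  rewrite /ka; case: (eqVneq (p t s) 0) => [ps|ps]; last by rewrite mulrC divfK.
  rewrite ps mul0r; apply/eqP; rewrite eq_le D0 -{1}ps /p.
  by rewrite (ler_sumr_term (F := D t s)).
pose pi t (h : {ffun S -> X}) := \prod_s ka t s (h s).
have pi0 t h : 0 <= pi t h by apply: prodr_ge0.
have pi1 t : \sum_h pi t h = 1 by exact: sum_prod_pmf.
have piE t s x : \sum_h pi t h * (x == h s)%:R = ka t s x.
  have := @resample _ _ (ka t) (ka1 t) xpredT s x (fun _ _ _ => erefl).
  rewrite /= sum_prod_pmf// mulr1 => <-; rewrite [RHS]big_mkcond/=.
  by apply: eq_bigr => h _; rewrite eq_sym; case: eqP; rewrite ?mulr1 ?mulr0.
(* The slice of t when strategy [h] is played. Its state marginal does not depend on [h], so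
   revealing [h] leaves H(S | U) unchanged and can only lower H(Y | U). *)
pose e t (h : {ffun S -> X}) s x := p t s * (x == h s)%:R.
have e0 t h s x : 0 <= e t h s x by rewrite mulr_ge0// ler0n.
have eS t h s : \sum_x e t h s x = p t s.
  rewrite /e -mulr_sumr (bigD1 (h s))//= eqxx big1 ?addr0 ?mulr1// => x.
  by move=> /negbTE ->.
have eD t s x : \sum_h pi t h * e t h s x = D t s x.
  by under eq_bigr do rewrite mulrCA; rewrite -mulr_sumr piE pka.
exists (fun u s x => pi u.1 u.2 * e u.1 u.2 s x); split.
- by move=> u s x; exact: mulr_ge0.
- move=> [t h] s x x' xx' /=; rewrite /e.
  have [xh|xh] := eqVneq x (h s); last by rewrite !mulr0 mul0r.
  by rewrite -xh eq_sym (negbTE xx') !mulr0.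
- by move=> s x; rewrite sumr_pair; apply: eq_bigr => t _ /=; rewrite eD.
rewrite sumr_pair; apply: ler_sum => t _ /=.
under eq_bigr do rewrite phiZ// /phi mulrBr.
rewrite sumrB.
under eq_bigr do under eq_bigr do rewrite eS.
rewrite -mulr_suml pi1 mul1r lerD2l lerN2.
under eq_bigr do rewrite mulr_sumr.
rewrite exchange_big/=; apply: ler_sum => y _.
have -> : lin (fun s x => V s x y) (D t)
    = \sum_h pi t h * lin (fun s x => V s x y) (e t h).
  under eq_bigr do rewrite -linZ; rewrite -lin_sum; apply: eq_lin => s x.
  by rewrite eD.
by apply: eta_jensen => // h; apply: lin_ge0.
Qed.

(** Only the weights of the slices [D t] vary. By homogeneity of [phi] the objective is linear in
    them, and rescaling a slice preserves determinism. The condition on [c] makes the total mass a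
    combination of the constraints. *)
Lemma scheme_support_reduction (T J : finType) (a : J -> S -> X -> R) (c : J -> R)
    (D : T -> S -> X -> R) :
  (forall s x, \sum_j c j * a j s x = 1) ->
  (forall t s x, 0 <= D t s x) -> deterministic D ->
  exists D' : 'I_#|J| -> S -> X -> R,
    [/\ forall t s x, 0 <= D' t s x, deterministic D',
       forall j, \sum_t lin (a j) (D' t) = \sum_t lin (a j) (D t)
     & \sum_t phi (D t) <= \sum_t phi (D' t)].
Proof.
move=> ca D0 Ddet; pose tot t := \sum_s \sum_x D t s x.
have totE t : tot t = \sum_j c j * lin (a j) (D t).
  rewrite /tot /lin; under [RHS]eq_bigr do rewrite mulr_sumr.
  rewrite [RHS]exchange_big; apply: eq_bigr => s _ /=.
  under [RHS]eq_bigr do rewrite mulr_sumr.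
  rewrite [RHS]exchange_big; apply: eq_bigr => x _ /=.
  by under [RHS]eq_bigr do rewrite mulrCA; rewrite -mulr_sumr ca mulr1.
have tot_ge t s x : D t s x <= tot t.
  apply: le_trans (ler_sumr_term s _); first exact: (ler_sumr_term (F := D t s)).
  by move=> s'; apply: sumr_ge0.
(* Empty slices get weight 0, since [sparse_weights] asks for positive total mass wherever the
   weight is positive. *)
pose w t : R := (tot t != 0)%:R.
have w0 t : 0 <= w t by exact: ler0n.
have wD t s x : w t * D t s x = D t s x.
  rewrite /w; case: eqP => [tt|_]; last by rewrite mul1r.
  by rewrite mul0r; apply/eqP; rewrite eq_le D0 -tt tot_ge.
have wlin b t : w t * lin b (D t) = lin b (D t).
  by rewrite -linZ; apply: eq_lin.
have wphi t : w t * phi (D t) = phi (D t).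
  by rewrite -phiZ//; apply: eq_phi.
have [u|w' [w'0 w'J w'v w'f]] := @sparse_weights T J (fun t j => lin (a j) (D t))
    (fun t => phi (D t)) c w w0.
  rewrite -totE /w; case: eqP => [_|/eqP tu _]; first by rewrite ltxx.
  by rewrite lt_def tu /tot; do 2![apply: sumr_ge0 => ? _].
set A := [set u | w' u != 0] in w'J.
pose D' (k : 'I_#|J|) s x := oapp (fun i : 'I_#|A| =>
  w' (enum_val i) * D (enum_val i) s x) 0 (insub (val k)).
have w'A u : u \notin A -> w' u = 0 by rewrite inE negbK => /eqP.
exists D'; split.
- by move=> k s x; rewrite /D'; case: insub => //= i; exact: mulr_ge0.
- move=> k s x x' xx'; rewrite /D'; case: insub => /= [i|]; last by rewrite mul0r.
  by rewrite mulrACA Ddet// mulr0.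
- move=> j; transitivity (\sum_t w' t * lin (a j) (D t)); last first.
    by rewrite w'v; apply: eq_bigr => t _; exact: wlin.
  rewrite -(sum_enum_val_insub w'J); last by move=> u /w'A ->; rewrite mul0r.
  apply: eq_bigr => k _; rewrite /D'; case: insub => /= [i|]; first by rewrite -linZ.
  by rewrite /lin big1// => s _; rewrite big1// => x _; rewrite mul0r.
- under eq_bigr do rewrite -wphi.
  apply: (le_trans w'f); rewrite -(sum_enum_val_insub w'J); last first.
    by move=> u /w'A ->; rewrite mul0r.
  apply: ler_sum => k _; rewrite /D'; case: insub => /= [i|]; first by rewrite -phiZ.
  by rewrite phi0.
Qed.

End Schemes.

(** * Single-letterization of a code *)

Lemma law_marginal (Om A B : finType) (P : Om -> R) (f : Om -> A) (g : Om -> B) a :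
  law P f a = \sum_b law P (fun w => (f w, g w)) (a, b).
Proof.
by rewrite /law (partition_big g xpredT).
Qed.

Section SingleLetter.
Variables (S X Y : finType) (V : S -> X -> Y -> R).
Hypothesis V0 : forall s x y, 0 <= V s x y.
Hypothesis V1 : forall s x, \sum_y V s x y = 1.
Variables (n : nat) (C D : finType) (wt : C -> R) (mk : C -> D).
Variables (sv : C -> {ffun 'I_n -> S}) (xv : C -> {ffun 'I_n -> X}).
Hypothesis wt0 : forall c, 0 <= wt c.
Hypothesis wt1 : \sum_c wt c = 1.

Let Om : finType := (C * {ffun 'I_n -> Y})%type.

Definition joint (w : Om) : R := wt w.1 * \prod_j V (sv w.1 j) (xv w.1 j) (w.2 j).
Local Notation P := joint.

Lemma joint_ge0 w : 0 <= P w.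
Proof. by rewrite /joint mulr_ge0// prodr_ge0. Qed.

Lemma joint_fst (F : C -> R) : \sum_w P w * F w.1 = \sum_c wt c * F c.
Proof.
rewrite sumr_pair; apply: eq_bigr => c _ /=.
under eq_bigr do rewrite /joint/= mulrAC.
by rewrite -mulr_sumr (sum_prod_pmf (V := fun j => V (sv c j) (xv c j))) ?mulr1.
Qed.

Lemma joint1 : \sum_w P w = 1.
Proof.
by have /= := joint_fst (fun=> 1); rewrite -!mulr_suml !mulr1 wt1.
Qed.

(* U_i = (M, K, Y^{i-1}, S_{i+1}^n) *)
Definition aux (i : nat) (w : Om) : D * {ffun 'I_n -> option (Y + S)} :=
  (mk w.1, [ffun j : 'I_n => if (j < i)%N then Some (inl (w.2 j))
                      else if (i < j)%N then Some (inr (sv w.1 j)) else None]).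

(* (M, K, Y^i, S_{i+1}^n) *)
Definition hybrid (i : nat) (w : Om) : D * {ffun 'I_n -> Y + S} :=
  (mk w.1, [ffun j : 'I_n => if (j < i)%N then inl (w.2 j) else inr (sv w.1 j)]).

Lemma ent_aux_state (i : 'I_n) : ent P (fun w => (aux i w, sv w.1 i)) = ent P (hybrid i).
Proof.
apply: ent_eq => w w'; rewrite !xpair_eqE -andbA; congr andb.
apply/andP/eqP => [[/eqP/ffunP h /eqP si]|/ffunP h].
  apply/ffunP => j; have := h j; rewrite !ffunE.
  have [ji [->]//|//|/val_inj ->] := ltngtP j i; last by rewrite si.
  by move=> ij [->].
split; last by have := h i; rewrite !ffunE ltnn => -[->].
apply/eqP/ffunP => j; have := h j; rewrite !ffunE.
by have [ji [->]|ij [->]|] := ltngtP j i.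
Qed.

Lemma ent_aux_output (i : 'I_n) : ent P (fun w => (aux i w, w.2 i)) = ent P (hybrid i.+1).
Proof.
apply: ent_eq => w w'; rewrite !xpair_eqE -andbA; congr andb.
apply/andP/eqP => [[/eqP/ffunP h /eqP yi]|/ffunP h].
  apply/ffunP => j; have := h j; rewrite !ffunE ltnS (leq_eqVlt j).
  have [ji [->]//|ij [->]//|/val_inj ->] := ltngtP j i; last by rewrite yi.
split; last by have := h i; rewrite !ffunE ltnSn => -[->].
apply/eqP/ffunP => j; have := h j; rewrite !ffunE ltnS (leq_eqVlt j).
by have [ji [->]|ij [->]|] := ltngtP j i.
Qed.

Definition letter_law (i : 'I_n) u s x : R :=
  law P (fun w => (aux i w, sv w.1 i, xv w.1 i)) (u, s, x).

(** The Markov chain U_i - (S_i, X_i) - Y_i: once the message, key, states and inputs are fixed, U_i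
    depends on the outputs before time i only, so [resample] replaces the factor of time i by the
    channel law. *)
Lemma law_aux_output (i : 'I_n) u b :
  law P (fun w => (aux i w, w.2 i)) (u, b) = lin (fun s x => V s x b) (letter_law i u).
Proof.
rewrite /lin pair_bigA /=.
rewrite /law big_mkcond (sumr_pair (A := C)) /=.
under [RHS]eq_bigr => sx _.
  rewrite /letter_law /law big_mkcond (sumr_pair (A := C)) /= mulr_suml.
  over.
rewrite [RHS]exchange_big; apply: eq_bigr => c _ /=.
rewrite [RHS](bigD1 (sv c i, xv c i))//= [X in _ + X]big1 ?addr0; last first.
  move=> [s x] sx; rewrite big1 ?mul0r// => y _.
  by rewrite ifF// !xpair_eqE -andbA -xpair_eqE [X in _ && X]eq_sym (negbTE sx) andbF.
pose Q (y : {ffun 'I_n -> Y}) := aux i (c, y) == u.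
have := @resample _ _ (fun j => V (sv c j) (xv c j)) (fun j => V1 _ _) Q i b.
rewrite big_mkcond [X in _ * X]big_mkcond/= => HQ.
transitivity (wt c * \sum_(y : {ffun 'I_n -> Y})
    if Q y && (y i == b) then \prod_j V (sv c j) (xv c j) (y j) else 0).
  rewrite mulr_sumr; apply: eq_bigr => y _; rewrite xpair_eqE -/(Q y).
  by case: ifP; rewrite ?mulr0.
rewrite HQ; last first.
  move=> y y' yy'; rewrite /Q; congr (_ == _); congr pair.
  apply/ffunP => j; rewrite !ffunE; case: ifP => // ji.
  by rewrite yy'// -val_eqE/= neq_ltn ji.
rewrite mulrCA mulrC; congr (_ * _); rewrite mulr_sumr; apply: eq_bigr => y _.
by rewrite !xpair_eqE !eqxx !andbT -/(Q y); case: ifP; rewrite ?mulr0.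
Qed.

Lemma output_marginal (i : 'I_n) (F : Y -> R) :
  \sum_w P w * F (w.2 i) = \sum_c wt c * \sum_b V (sv c i) (xv c i) b * F b.
Proof.
rewrite sumr_pair; apply: eq_bigr => c _ /=; rewrite /joint /=.
under eq_bigr do rewrite -mulrA; rewrite -mulr_sumr; congr (_ * _).
rewrite (partition_big (fun y : {ffun 'I_n -> Y} => y i) xpredT)//=.
apply: eq_bigr => b _.
have V1' j : \sum_b V (sv c j) (xv c j) b = 1 by exact: V1.
have := @resample _ _ _ V1' xpredT i b (fun _ _ _ => erefl).
rewrite /= (sum_prod_pmf V1') mulr1 => <-; rewrite mulr_suml.
by apply: eq_bigr => y /eqP ->.
Qed.

Definition code_scheme (t : 'I_n * (D * {ffun 'I_n -> option (Y + S)})) s x : R :=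
  n%:R^-1 * letter_law t.1 t.2 s x.

Lemma code_scheme_ge0 t s x : 0 <= code_scheme t s x.
Proof. by rewrite mulr_ge0// ?invr_ge0 ?ler0n// law_ge0//; exact: joint_ge0. Qed.

Lemma code_scheme_lin (a : S -> X -> R) :
  \sum_t lin a (code_scheme t)
  = n%:R^-1 * \sum_(i < n) \sum_c wt c * a (sv c i) (xv c i).
Proof.
rewrite sumr_pair mulr_sumr; apply: eq_bigr => i _ /=.
under eq_bigr do rewrite /code_scheme linZ /=.
rewrite -mulr_sumr; congr (_ * _).
rewrite -(joint_fst (fun c => a (sv c i) (xv c i))).
rewrite (sum_law P (fun w => (aux i w, sv w.1 i, xv w.1 i))
  (fun v => a v.1.2 v.2)).
by rewrite [RHS]sumr_pair [RHS]sumr_pair.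
Qed.

(** Summed over u, [phi] of the slices of time i is H(U_i, S_i) - H(U_i, Y_i), a difference of
    entropies of consecutive hybrids. *)
Lemma code_scheme_phi : (0 < n)%N ->
  n%:R * \sum_t phi V (code_scheme t) = ent P (hybrid 0) - ent P (hybrid n).
Proof.
move=> n0.
have n0' : n%:R != 0 :> R by rewrite pnatr_eq0 -lt0n.
rewrite sumr_pair.
have -> : \sum_(i < n) \sum_u phi V (code_scheme (i, u))
    = n%:R^-1 * \sum_(i < n) (ent P (hybrid i) - ent P (hybrid i.+1)).
  rewrite mulr_sumr; apply: eq_bigr => i _.
  under eq_bigr => u _.
    rewrite /code_scheme/= phiZ//; first over.
    by rewrite invr_ge0 ler0n.
    by move=> s x; rewrite law_ge0//; exact: joint_ge0.
  rewrite -mulr_sumr; congr (_ * _).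
  rewrite -ent_aux_state -ent_aux_output !ent_law.
  rewrite !(sumr_pair (A := (D * {ffun 'I_n -> option (Y + S)})%type)) -sumrB.
  apply: eq_bigr => u _; rewrite /phi; congr (_ - _).
    by apply: eq_bigr => s _; congr eta; rewrite (law_marginal _ _ (fun w => xv w.1 i)).
  by apply: eq_bigr => y _; rewrite law_aux_output.
rewrite mulVKf//.
pose f i := - ent P (hybrid i).
transitivity (f n - f 0%N); last by rewrite /f; lra.
rewrite -(telescope_sumr f (leq0n n)) big_mkord.
by apply: eq_bigr => i _; rewrite /f; lra.
Qed.

End SingleLetter.

(** * Entropies at the two ends of the telescope *)

Section CodeEntropy.
Variables (S X Y : finType) (PS : S -> R) (V : S -> X -> Y -> R).
Hypothesis PS0 : forall s, 0 <= PS s.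
Hypothesis PS1 : \sum_s PS s = 1.
Hypothesis V0 : forall s x y, 0 <= V s x y.
Hypothesis V1 : forall s x, \sum_y V s x y = 1.
Variables (n : nat) (C M K : finType) (wt : C -> R) (mk : C -> M * K).
Variables (sv : C -> {ffun 'I_n -> S}) (xv : C -> {ffun 'I_n -> X}).
Variable dec : {ffun 'I_n -> Y} -> K -> M.
Hypothesis wt0 : forall c, 0 <= wt c.
Hypothesis wt1 : \sum_c wt c = 1.
Hypothesis n0 : (0 < n)%N.
Hypothesis M0 : (0 < #|M|)%N.
Hypothesis K0 : (0 < #|K|)%N.
Hypothesis wtS : forall F : M * K -> {ffun 'I_n -> S} -> R,
  \sum_c wt c * F (mk c) (sv c)
  = (#|M|%:R * #|K|%:R)^-1 * \sum_d \sum_(s : {ffun 'I_n -> S}) (\prod_j PS (s j)) * F d s.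

Local Notation P := (joint V wt sv xv).

Let M0R : 0 < #|M|%:R :> R. Proof. by rewrite ltr0n. Qed.
Let K0R : 0 < #|K|%:R :> R. Proof. by rewrite ltr0n. Qed.
Let n0R : 0 < n%:R :> R. Proof. by rewrite ltr0n. Qed.
Let P0 := joint_ge0 V0 sv xv wt0.
Let P1 := joint1 V1 sv xv wt1.

Lemma state_marginal j (F : S -> R) : \sum_c wt c * F (sv c j) = \sum_s PS s * F s.
Proof.
rewrite (wtS (fun _ s => F (s j))) sumr_const card_prod.
rewrite -[X in _ * X]mulr_natl natrM mulrA mulVf ?mul1r; last first.
  by rewrite mulf_neq0 ?gt_eqF.
rewrite (partition_big (fun s : {ffun 'I_n -> S} => s j) xpredT)//=.
apply: eq_bigr => a _.
have := @resample _ _ (fun _ => PS) (fun _ => PS1) xpredT j a (fun _ _ _ => erefl).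
rewrite /= (sum_prod_pmf (V := fun _ => PS))// mulr1 => <-.
by rewrite mulr_suml; apply: eq_bigr => s /eqP ->.
Qed.

(** [hybrid 0] amounts to (M, K, S^n), which by [wtS] is uniform on pairs (M, K) times the IID law
    of the states; its entropy is thus known exactly. *)
Lemma ent_message_state :
  ent P (hybrid mk sv 0) = ln #|M|%:R + ln #|K|%:R + n%:R * \sum_s eta (PS s).
Proof.
pose f (w : C * {ffun 'I_n -> Y}) := (mk w.1, sv w.1).
have -> : ent P (hybrid mk sv 0) = ent P f.
  apply: ent_eq => w w'; rewrite !xpair_eqE; congr andb.
  apply/eqP/eqP => [/ffunP h|->//]; apply/ffunP => j.
  by have := h j; rewrite !ffunE ltn0 => -[].
have lawf d s : law P f (d, s) = (#|M|%:R * #|K|%:R)^-1 * \prod_j PS (s j).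
  transitivity (\sum_w P w * ((mk w.1, sv w.1) == (d, s))%:R).
    rewrite /law big_mkcond; apply: eq_bigr => w _; rewrite /f.
    by case: ifP; rewrite ?mulr1 ?mulr0.
  rewrite (joint_fst V1 wt sv xv (fun c => ((mk c, sv c) == (d, s))%:R)).
  rewrite (wtS (fun d' s' => ((d', s') == (d, s))%:R)); congr (_ * _).
  rewrite (pair_bigA _ (fun d' (s' : {ffun 'I_n -> S}) => (\prod_j PS (s' j)) * ((d', s') == (d, s))%:R)) /=.
  rewrite (bigD1 (d, s))//= eqxx mulr1 [X in _ + X]big1 ?addr0// => -[d' s'] /negbTE /= ->.
  by rewrite mulr0.
rewrite /ent.
have -> : \sum_w P w * ln (law P f (f w))
    = \sum_w P w * (- ln #|M|%:R - ln #|K|%:R + \sum_j ln (PS (sv w.1 j))).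
  apply: eq_bigr => w _; have [->|Pw] := eqVneq (P w) 0; first by rewrite !mul0r.
  congr (_ * _).
  have : 0 < law P f (f w).
    by apply: lt_le_trans (law_ge P0 f w); rewrite lt_def Pw P0.
  rewrite /f lawf => lw.
  have c0 : 0 < (#|M|%:R * #|K|%:R)^-1 :> R by rewrite invr_gt0 mulr_gt0.
  have PSj j : 0 < PS (sv w.1 j).
    rewrite lt_def PS0 andbT; apply/negP => /eqP PSj; move: lw.
    by rewrite (bigD1 j)//= PSj mul0r mulr0 ltxx.
  rewrite lnM//; last by apply: prodr_gt0.
  by rewrite lnV ?mulr_gt0// lnM// ln_prod// opprD.
under eq_bigr do rewrite mulrDr.
rewrite big_split/= -mulr_suml P1 mul1r.
rewrite (joint_fst V1 wt sv xv (fun c => \sum_j ln (PS (sv c j)))).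
have -> : \sum_c wt c * (\sum_j ln (PS (sv c j)))
    = \sum_(j < n) \sum_c wt c * ln (PS (sv c j)).
  by rewrite exchange_big; apply: eq_bigr => c _; rewrite mulr_sumr.
under [X in - (_ + X)]eq_bigr => j _ do rewrite (state_marginal j (fun s => ln (PS s))).
rewrite sumr_const card_ord -[X in _ + X]mulr_natl /eta sumrN; lra.
Qed.

Definition error_prob : R := \sum_w P w * ((mk w.1).1 != dec w.2 (mk w.1).2)%:R.

(** The law of the output at a uniformly chosen time, which is the law of Y in the time-shared
    scheme. *)
Definition avg_output b : R := n%:R^-1 * \sum_(i < n) \sum_c wt c * V (sv c i) (xv c i) b.

Lemma avg_output_law b :
  avg_output b = n%:R^-1 * \sum_(i < n) law P (fun w => w.2 i) b.
Proof.
congr (_ * _); apply: eq_bigr => i _.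
transitivity (\sum_w P w * (w.2 i == b)%:R).
  rewrite (output_marginal V1 wt sv xv i (fun b' => (b' == b)%:R)).
  apply: eq_bigr => c _; rewrite (bigD1 b)//= eqxx mulr1 big1 ?addr0// => b'.
  by move=> /negbTE ->; rewrite mulr0.
rewrite /law [RHS]big_mkcond; apply: eq_bigr => w _.
by case: ifP; rewrite ?mulr1 ?mulr0.
Qed.

Lemma avg_output_expect (F : Y -> R) :
  \sum_w P w * (\sum_i F (w.2 i)) = n%:R * \sum_b avg_output b * F b.
Proof.
under eq_bigr do rewrite mulr_sumr.
rewrite exchange_big/=.
under eq_bigr => i _ do rewrite (sum_law P (fun w => w.2 i) F).
rewrite exchange_big mulr_sumr; apply: eq_bigr => b _ /=.
rewrite avg_output_law -mulr_suml !mulrA divff ?mul1r//.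
by rewrite gt_eqF.
Qed.

(* Fano's inequality, H(Y^n | K) <= n H(Y) and H(K) <= ln |K| all at once, by a
   single application of Gibbs' inequality. *)
Lemma ent_message_output :
  ent P (hybrid mk sv n)
  <= n%:R * \sum_b eta (avg_output b) + ln #|K|%:R + ln 2 + error_prob * ln #|M|%:R.
Proof.
pose f (w : C * {ffun 'I_n -> Y}) := (mk w.1, w.2).
have -> : ent P (hybrid mk sv n) = ent P f.
  apply: ent_eq => w w'; rewrite !xpair_eqE; congr andb.
  apply/eqP/eqP => [/ffunP h|->]; apply/ffunP => j.
    by have := h j; rewrite !ffunE ltn_ord => -[].
  by rewrite !ffunE ltn_ord.
have avg0 b : 0 <= avg_output b.
  rewrite mulr_ge0 ?invr_ge0 ?ler0n//; do 2![apply: sumr_ge0 => ? _].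
  exact: mulr_ge0.
have avg1 : \sum_b avg_output b = 1.
  rewrite -mulr_sumr exchange_big/=.
  have -> : \sum_(i < n) \sum_b \sum_c wt c * V (sv c i) (xv c i) b = \sum_(i < n) 1.
    apply: eq_bigr => i _; rewrite exchange_big -[RHS]wt1/=; apply: eq_bigr => c _.
    by rewrite -mulr_sumr V1 mulr1.
  by rewrite sumr_const card_ord mulVf// gt_eqF.
(* The reference law of M given (K, Y^n): half uniform, half on the decoded message. Its logarithmic
   cost is at most ln 2 if decoding is correct and exactly ln 2 + ln |M| otherwise, which is Fano's
   bound. *)
pose r m k y : R := (2 * #|M|%:R)^-1 + 2^-1 * (m == dec y k)%:R.
have r0 m k y : 0 < r m k y.
  rewrite /r; apply: ltr_wpDr; first by rewrite mulr_ge0 ?ler0n// invr_ge0 ler0n.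
  by rewrite invr_gt0 mulr_gt0 ?ltr0n.
have r1 k y : \sum_m r m k y = 1.
  rewrite /r big_split/= sumr_const -mulr_sumr (bigD1 (dec y k))//= eqxx.
  rewrite big1 ?addr0 ?mulr1 => [|m /negbTE ->//].
  rewrite -[X in X + _]mulr_natl invfM mulrCA divff ?mulr1 ?gt_eqF//; lra.
pose q (v : (M * K) * {ffun 'I_n -> Y}) :=
  #|K|%:R^-1 * r v.1.1 v.1.2 v.2 * \prod_j avg_output (v.2 j).
have q0 v : 0 <= q v.
  by rewrite mulr_ge0 ?prodr_ge0// mulr_ge0 ?invr_ge0 ?ler0n// ltW.
have avgP u j : 0 < P u -> 0 < avg_output (u.2 j).
  move=> Pu; rewrite avg_output_law mulr_gt0 ?invr_gt0//.
  apply: (@lt_le_trans _ _ (law P (fun w => w.2 j) (u.2 j))).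
    exact: lt_le_trans Pu (law_ge P0 _ u).
  by apply: (ler_sumr_term (F := fun i => law P (fun w => w.2 i) (u.2 j))) => i; exact: law_ge0.
have qsum : \sum_v q v = 1.
  rewrite sumr_pair exchange_big/= -[RHS](sum_prod_pmf (I := 'I_n) (fun _ => avg1)).
  apply: eq_bigr => y _; rewrite /q/= -mulr_suml -[RHS]mul1r; congr (_ * _).
  rewrite -mulr_sumr sumr_pair exchange_big/=.
  under eq_bigr do rewrite r1.
  by rewrite sumr_const mulVf// gt_eqF.
have Pq u : 0 < P u -> 0 < q (f u).
  move=> Pu; rewrite /q mulr_gt0 ?mulr_gt0 ?invr_gt0 ?prodr_gt0// => j _.
  exact: avgP.
apply: (le_trans (ent_gibbs P0 q0 Pq _)); first by rewrite qsum P1.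
have : \sum_w P w * (- ln #|K|%:R - ln 2
      - ((mk w.1).1 != dec w.2 (mk w.1).2)%:R * ln #|M|%:R
      + \sum_j ln (avg_output (w.2 j))) <= \sum_w P w * ln (q (f w)).
  apply: ler_sum => w _; have [->|Pw] := eqVneq (P w) 0; first by rewrite !mul0r.
  have Pw0 : 0 < P w by rewrite lt_def Pw P0.
  rewrite ler_pM2l// /q lnM ?mulr_gt0 ?invr_gt0 ?prodr_gt0//; last first.
    by move=> j _; exact: avgP.
  rewrite lnM ?invr_gt0// lnV// ln_prod => [|j]; last exact: avgP.
  rewrite lerD2r -addrA lerD2l /r /=.
  case: eqP => _ /=; rewrite ?mul0r ?mulr0 ?mul1r ?mulr1.
    rewrite subr0 -lnV ?ltr0n// ler_ln ?invr_gt0 ?ltr0n// lerDr.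
    by rewrite invr_ge0 mulr_ge0 ?ler0n.
  by rewrite addr0 lnV ?mulr_gt0 ?ltr0n// lnM ?ltr0n// opprD.
have -> : \sum_w P w * (- ln #|K|%:R - ln 2
      - ((mk w.1).1 != dec w.2 (mk w.1).2)%:R * ln #|M|%:R
      + \sum_j ln (avg_output (w.2 j)))
    = - ln #|K|%:R - ln 2 - error_prob * ln #|M|%:R + n%:R * \sum_b avg_output b * ln (avg_output b).
  under eq_bigr do rewrite mulrDr mulrBr.
  rewrite big_split/= (avg_output_expect (fun b => ln (avg_output b))) sumrB.
  rewrite -mulr_suml P1 mul1r /error_prob mulr_suml.
  by under [X in _ - X + _ = _]eq_bigr do rewrite mulrA.
rewrite /eta sumrN; lra.
Qed.

(** [phi] of the aggregate mass is H(S) - H(Y) for the time-shared letters, so n H(S), n H(Y) and ln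
    |K| all cancel between the two ends of the telescope. Averages of every function of (S, X) are
    preserved, which covers cost and warden at once. *)
Lemma code_converse : exists (T : finType) (D : T -> S -> X -> R),
  [/\ forall t s x, 0 <= D t s x,
     forall a : S -> X -> R,
       \sum_t lin a (D t) = n%:R^-1 * \sum_(i < n) \sum_c wt c * a (sv c i) (xv c i),
     forall s, \sum_x \sum_t D t s x = PS s
   & ln #|M|%:R - error_prob * ln #|M|%:R - ln 2
     <= n%:R * (\sum_t phi V (D t) - phi V (fun s x => \sum_t D t s x))].
Proof.
exists _, (code_scheme V wt mk sv xv).
have lin_scheme := code_scheme_lin V1 wt mk sv xv.
have margS s : \sum_x \sum_t code_scheme V wt mk sv xv t s x = PS s.
  transitivity (lin (fun s' _ => (s' == s)%:R)
      (fun s x => \sum_t code_scheme V wt mk sv xv t s x)).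
    rewrite /lin (bigD1 s)//= [X in _ + X]big1 ?addr0 => [|s' /negbTE ->].
      by apply: eq_bigr => x _; rewrite eqxx mulr1.
    by rewrite big1// => x _; rewrite mulr0.
  rewrite lin_sum lin_scheme.
  under eq_bigr => j _ do rewrite (state_marginal j (fun s' => (s' == s)%:R)).
  rewrite sumr_const card_ord -[X in _ * X]mulr_natl mulrA mulVf ?gt_eqF// mul1r.
  rewrite (bigD1 s)//= eqxx mulr1 big1 ?addr0// => s' /negbTE ->.
  by rewrite mulr0.
split=> //; first exact: code_scheme_ge0.
rewrite mulrBr (code_scheme_phi V0 V1)// ent_message_state.
have -> : phi V (fun s x => \sum_t code_scheme V wt mk sv xv t s x)
    = \sum_s eta (PS s) - \sum_b eta (avg_output b).
  congr (_ - _); first by apply: eq_bigr => s _; rewrite margS.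
  by apply: eq_bigr => b _; rewrite lin_sum lin_scheme.
have := ent_message_output; lra.
Qed.

End CodeEntropy.

(** * Limits *)

Section Sequences.
Implicit Types (u v : nat -> R) (l : R).

Lemma Un_cvP u l : Un_cv u l <->
  forall e : R, 0 < e -> exists N, forall n, (N <= n)%N -> `|u n - l| < e.
Proof.
split=> ul e e0.
  have [N uN] := ul e (elimT RltP e0); exists N => n /ssrnat.leP Nn.
  by apply/RltP; rewrite -RdistE; exact: uN.
have [N uN] := ul e (introT RltP e0); exists N => n /ssrnat.leP Nn.
by rewrite RdistE; apply/RltP; exact: uN.
Qed.

Lemma Un_cv_cst l : Un_cv (fun=> l) l.
Proof. by apply/Un_cvP => e e0; exists 0%N => n _; rewrite subrr normr0. Qed.

Lemma Un_cv_sum (I : finType) (u : I -> nat -> R) (l : I -> R) :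
  (forall i, Un_cv (u i) (l i)) -> Un_cv (fun n => \sum_i u i n) (\sum_i l i).
Proof.
move=> ul; elim: (index_enum I) => [|i r IH].
  by rewrite big_nil; apply: Un_cv_ext (Un_cv_cst 0) => n; rewrite big_nil.
rewrite big_cons; apply: Un_cv_ext (CV_plus _ _ _ _ (ul i) IH) => n.
by rewrite big_cons.
Qed.

Lemma Un_cv_subseq u l (h : nat -> nat) :
  (forall n, (n <= h n)%N) -> Un_cv u l -> Un_cv (fun n => u (h n)) l.
Proof.
move=> hn /Un_cvP ul; apply/Un_cvP => e /ul[N uN]; exists N => n Nn.
exact: uN (leq_trans Nn (hn n)).
Qed.

Lemma Un_cv_le u v l l' : (forall n, u n <= v n) -> Un_cv u l -> Un_cv v l' -> l <= l'.
Proof.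
by move=> uv ul vl; apply/RleP; apply: Rle_cv_lim ul vl => n; apply/RleP.
Qed.

(** The index [h n] is chosen beyond n and within 1/(n+1) of a cluster point. It need not increase
    with n: the bound n <= [h n] suffices to carry limits over. *)
Lemma bounded_subsequence1 u : (forall n, 0 <= u n <= 1) ->
  exists (h : nat -> nat) l, (forall n, (n <= h n)%N) /\ Un_cv (fun n => u (h n)) l.
Proof.
move=> u01; have [|l ul] := @Bolzano_Weierstrass u _ (compact_P3 0 1).
  by move=> n; have /andP[/RleP ? /RleP ?] := u01 n; split.
have adh n : exists p, (n <= p)%N && (`|u p - l| < n.+1%:R^-1).
  have e0 : 0 < n.+1%:R^-1 :> R by rewrite invr_gt0 ltr0n.
  have [p [/ssrnat.leP np up]] := ul (disc l (mkposreal _ (elimT RltP e0))) n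
    (ex_intro _ (mkposreal _ (elimT RltP e0)) (fun x h => h)).
  by exists p; rewrite np; apply/RltP; rewrite -RabsE.
exists (fun n => xchoose (adh n)), l; split=> [n|].
  by have /andP[] := xchooseP (adh n).
apply/Un_cvP => e e0; exists (Num.bound e^-1) => n Nn.
have /andP[_ /lt_trans->//] := xchooseP (adh n).
rewrite invf_plt ?posrE// ?ltr0n//.
apply: lt_le_trans (archi_boundP _) _; first by rewrite invr_ge0 ltW.
by rewrite ler_nat; exact: leqW.
Qed.

Lemma bounded_subsequence (I : finType) (a : nat -> I -> R) :
  (forall n i, 0 <= a n i <= 1) ->
  exists (h : nat -> nat) (l : I -> R),
    (forall n, (n <= h n)%N) /\ forall i, Un_cv (fun n => a (h n) i) (l i).
Proof.
move=> a01.
suff [h [l [hn hl]]] : exists (h : nat -> nat) (l : I -> R), (forall n, (n <= h n)%N)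
    /\ forall i, i \in index_enum I -> Un_cv (fun n => a (h n) i) (l i).
  by exists h, l; split=> // i; apply: hl; exact: mem_index_enum.
elim: (index_enum I) => [|j r [h [l [hn hl]]]]; first by exists id, (fun=> 0).
have [g [lj [gn gl]]] := bounded_subsequence1 (fun n => a01 (h n) j).
exists (h \o g), (fun i => if i == j then lj else l i); split=> [n|i].
  exact: leq_trans (gn n) (hn _).
rewrite inE; case: eqP => [->//|_ /= ir].
exact: Un_cv_subseq (hl i ir).
Qed.

Lemma Un_cv_eta u l : (forall n, 0 <= u n) -> Un_cv u l ->
  Un_cv (fun n => eta (u n)) (eta l).
Proof.
move=> u0 ul.
have : 0 <= l by exact: Un_cv_le u0 (Un_cv_cst 0) ul.
rewrite le_eqVlt => /predU1P[l0|l0]; last first.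
  apply: continuity_seq ul; apply: continuity_pt_opp.
  apply: (continuity_pt_mult id ln); first exact: derivable_continuous_pt (derivable_pt_id _).
  apply: derivable_continuous_pt; exists (Rinv l).
  by apply: derivable_pt_lim_ln; apply/RltP.
rewrite -l0 eta0 in ul *; move/Un_cvP: ul => ul; apply/Un_cvP => e e0.
(* The tangent of [eta] at a = e/2 bounds [eta (u n)] by a + u n |ln a|; the choice of [c] makes the
   second term less than a. *)
pose a := e / 2; have a0 : 0 < a by rewrite divr_gt0.
pose c := `|ln a| + 1; have c0 : 0 < c by rewrite ltr_wpDl.
have [N1 uN1] := ul 1 ltr01; have [N2 uN2] := ul (a / c) (divr_gt0 a0 c0).
exists (maxn N1 N2) => n; rewrite geq_max => /andP[/uN1 + /uN2].
rewrite !subr0 (ger0_norm (u0 n)) ltr_pdivlMr// => un1 unc.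
have eta_ge0 : 0 <= eta (u n).
  have := u0 n; rewrite le_eqVlt => /predU1P[<-|un0]; first by rewrite eta0.
  by rewrite /eta -mulrN mulr_ge0//; have := ln_le_sub1 un0; lra.
rewrite ger0_norm//; apply: le_lt_trans (eta_tangent (u0 n) (ltW a0) (fun=> a0)) _.
have : - (u n * ln a) <= u n * `|ln a| by rewrite -mulrN ler_wpM2l// -normrN ler_norm.
have : e = a + a by rewrite /a; field.
have := u0 n; move: unc; rewrite /c mulrDr mulr1; lra.
Qed.

End Sequences.

(* The tangent line of ln at 1 / (1 + e), for e = +/- delta, gives a linear lower
   bound of the divergence without going through Pinsker's inequality. *)
Lemma KL_ge_dist (A : finType) (p q : A -> R) (delta : R) :
  (forall a, 0 <= p a) -> \sum_a p a = 1 -> (forall a, 0 < q a) -> \sum_a q a = 1 ->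
  0 <= delta <= 1 / 2 ->
  delta * (\sum_a `|p a - q a|) <= KL p q + 2 * delta ^+ 2.
Proof.
move=> p0 p1 q0 q1 /andP[d0 d2].
have tangent a e : - (1 / 2) <= e <= 1 / 2 ->
    e * (p a - q a) - 2 * e ^+ 2 * p a <= p a * ln (p a / q a) - p a + q a.
  move=> /andP[e1 e2]; have := p0 a; rewrite le_eqVlt => /predU1P[<-|pa].
    by have := q0 a; rewrite !mul0r !mulr0; nra.
  have e10 : 0 < 1 + e by lra.
  have h1 : ln ((1 + e)^-1) <= (1 + e)^-1 - 1 by apply: ln_le_sub1; rewrite invr_gt0.
  have h2 : ln (q a * (1 + e) / p a) <= q a * (1 + e) / p a - 1.
    by apply: ln_le_sub1; rewrite divr_gt0// mulr_gt0.
  (* Clearing the denominator leaves e^2 (1 + 2 e) >= 0, whence the restriction of [delta] to at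
     most 1/2. *)
  have h3 : (1 + e)^-1 - 1 <= - e + 2 * e ^+ 2.
    rewrite lerBlDr -[leLHS]mul1r ler_pdivrMr//; nra.
  move: h1 h2; rewrite lnV// lnM ?mulr_gt0 ?invr_gt0// lnM// lnV// lnM ?invr_gt0// lnV//.
  move=> h1 h2; have {}h1 := le_trans h1 h3.
  have : p a * (q a * (1 + e) / p a) = q a * (1 + e).
    by rewrite mulrC divfK// gt_eqF.
  move: h2; rewrite -(ler_pM2l pa) => h2 h4; move: h2.
  rewrite (mulrBr _ (_ / _)) h4.
  move: h1; rewrite -(ler_pM2l pa); nra.
have -> : KL p q = \sum_a (p a * ln (p a / q a) - p a + q a).
  rewrite big_split sumrB/= p1 q1 subrK.
  by apply: eq_bigr => a _; rewrite RdivE.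
have -> : 2 * delta ^+ 2 = \sum_a 2 * delta ^+ 2 * p a.
  by rewrite -mulr_sumr p1 mulr1.
rewrite -big_split mulr_sumr; apply: ler_sum => a _ /=.
(* Giving e the sign of p a - q a turns the linear term into [delta] times the absolute value. *)
have [pq|pq] := leP 0 (p a - q a).
  by have := tangent a delta; rewrite ger0_norm//; lra.
by have := tangent a (- delta); rewrite ltr0_norm// sqrrN; lra.
Qed.

Section Continuity.
Variables (S X Y : finType) (V : S -> X -> Y -> R).
Hypothesis V0 : forall s x y, 0 <= V s x y.
Variables (d : nat -> S -> X -> R) (d' : S -> X -> R).
Hypothesis dd' : forall s x, Un_cv (fun n => d n s x) (d' s x).

Lemma Un_cv_lin (a : S -> X -> R) : Un_cv (fun n => lin a (d n)) (lin a d').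
Proof.
apply: Un_cv_sum => s; apply: Un_cv_sum => x.
exact: CV_mult (dd' s x) (Un_cv_cst _).
Qed.

Lemma Un_cv_phi : (forall n s x, 0 <= d n s x) -> Un_cv (fun n => phi V (d n)) (phi V d').
Proof.
move=> d0; apply: CV_minus; apply: Un_cv_sum => z; apply: Un_cv_eta.
- by move=> n; apply: sumr_ge0.
- by apply: Un_cv_sum => x.
- by move=> n; apply: lin_ge0.
- exact: Un_cv_lin.
Qed.

End Continuity.

Lemma scheme_limit (S X T : finType) (D : nat -> T -> S -> X -> R) :
  (forall n t s x, 0 <= D n t s x <= 1) -> (forall n, deterministic (D n)) ->
  exists (h : nat -> nat) (D' : T -> S -> X -> R),
    [/\ forall n, (n <= h n)%N, forall t s x, 0 <= D' t s x, deterministic D'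
     & forall t s x, Un_cv (fun n => D (h n) t s x) (D' t s x)].
Proof.
move=> D01 Ddet.
have [h [l [hn hl]]] := @bounded_subsequence (T * S * X)%type
  (fun n w => D n w.1.1 w.1.2 w.2) (fun n w => D01 n _ _ _).
exists h, (fun t s x => l (t, s, x)); split=> //.
- move=> t s x; apply: Un_cv_le (Un_cv_cst 0) (hl (t, s, x)) => n.
  by have /andP[] := D01 (h n) t s x.
- move=> t s x x' xx'; apply: UL_sequence (CV_mult _ _ _ _ (hl (t, s, x)) (hl (t, s, x'))) _.
  by apply: Un_cv_ext (Un_cv_cst 0) => n /=; rewrite RmultE Ddet.
- by move=> t s x; exact: hl (t, s, x).
Qed.

(** * Evaluation of deterministic schemes *)

Section Coordinates.
Variables (S X Y Z : finType) (V : S -> X -> Y -> R) (U : S -> X -> Z -> R) (b : X -> R).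
Hypothesis V1 : forall s x, \sum_y V s x y = 1.
Hypothesis U1 : forall s x, \sum_z U s x z = 1.

(** All that the constraints and [phi] see of an aggregate mass; it therefore suffices that the
    support reduction preserves these quantities. *)
Definition same_marginals (d d' : S -> X -> R) : Prop :=
  [/\ forall s, \sum_x d s x = \sum_x d' s x,
     forall y, lin (fun s x => V s x y) d = lin (fun s x => V s x y) d',
     forall z, lin (fun s x => U s x z) d = lin (fun s x => U s x z) d'
   & lin (fun _ => b) d = lin (fun _ => b) d'].

Lemma lin_indicator (s0 : S) (x0 : X) (d : S -> X -> R) :
  lin (fun s x => ((s, x) == (s0, x0))%:R) d = d s0 x0.
Proof.
rewrite /lin pair_bigA (bigD1 (s0, x0))//= eqxx mulr1 big1 ?addr0// => -[s x].
by move=> /negbTE /= ->; rewrite mulr0.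
Qed.

Lemma lin_indicator_state (s0 : S) (d : S -> X -> R) :
  lin (fun s _ => (s == s0)%:R) d = \sum_x d s0 x.
Proof.
rewrite /lin (bigD1 s0)//= [X in _ + X]big1 ?addr0 => [|s /negbTE ->].
  by apply: eq_bigr => x _; rewrite eqxx mulr1.
by rewrite big1// => x _; rewrite mulr0.
Qed.

Lemma lin_pmf_last (T : finType) (F : S -> X -> T -> R) (t0 : T) (d d' : S -> X -> R) :
  (forall s x, \sum_t F s x t = 1) ->
  (forall s, \sum_x d s x = \sum_x d' s x) ->
  (forall t, t != t0 -> lin (fun s x => F s x t) d = lin (fun s x => F s x t) d') ->
  forall t, lin (fun s x => F s x t) d = lin (fun s x => F s x t) d'.
Proof.
move=> F1 dS dF t; have [->|] := eqVneq t t0; last exact: dF.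
have : \sum_t lin (fun s x => F s x t) d = \sum_t lin (fun s x => F s x t) d'.
  by rewrite !sum_lin_pmf//; apply: eq_bigr => s _.
rewrite (bigD1 t0)//= [in RHS](bigD1 t0)//= (eq_bigr _ dF).
exact: addIr.
Qed.

(** Either all |X||S| point masses are kept, or |S| state masses, |Y| - 1 output masses, |Z| - 1
    warden masses and the cost, that is |S| + |Y| + |Z| - 1 coordinates. The omitted letters [y0]
    and [z0] are recovered from the total mass, which is the sum of the state masses and is what [c]
    selects. *)
Lemma marginal_coordinates (x0 : X) (y0 : Y) (z0 : Z) (s0 : S) :
  exists (J : finType) (a : J -> S -> X -> R) (c : J -> R),
    [/\ (#|J| <= minn (#|X| + #|Y| + #|Z| + #|S| - 3) (#|X| * #|S|))%N,
       forall s x, \sum_j c j * a j s x = 1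
     & forall d d', (forall j, lin (a j) d = lin (a j) d') -> same_marginals d d'].
Proof.
have cX : (0 < #|X|)%N by apply/card_gt0P; exists x0.
have cY : (0 < #|Y|)%N by apply/card_gt0P; exists y0.
have cZ : (0 < #|Z|)%N by apply/card_gt0P; exists z0.
have cS : (0 < #|S|)%N by apply/card_gt0P; exists s0.
have [le|gt] := leqP (#|X| * #|S|) (#|X| + #|Y| + #|Z| + #|S| - 3).
  exists (S * X)%type, (fun j s x => ((s, x) == (j.1, j.2))%:R), (fun=> 1); split.
  - by rewrite card_prod mulnC.
  - move=> s x; rewrite (bigD1 (s, x))//= eqxx mulr1 big1 ?addr0// => -[s' x'].
    by rewrite eq_sym => /negbTE /= ->; rewrite mulr0.
  - move=> d d' dd'.
    have dE s x : d s x = d' s x by have := dd' (s, x); rewrite /= !lin_indicator.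
    split=> [s|y|z|]; [exact: eq_bigr|exact: eq_lin..].
pose a (j : S + ({y | y != y0} + ({z | z != z0} + unit))) s x : R := match j with
  | inl s' => (s == s')%:R
  | inr (inl y) => V s x (val y)
  | inr (inr (inl z)) => U s x (val z)
  | inr (inr (inr _)) => b x
  end.
exists (S + ({y | y != y0} + ({z | z != z0} + unit)))%type, a,
  (fun j => if j is inl _ then 1 else 0); split.
- rewrite !card_sum card_unit !card_sig.
  have -> : #|[pred y | y != y0]| = #|Y|.-1 by rewrite -(cardC1 y0).
  have -> : #|[pred z | z != z0]| = #|Z|.-1 by rewrite -(cardC1 z0).
  (* The count |S| + |Y| + |Z| - 1 fits the bound only if |X| >= 2; for |X| = 1 the other choice of
     coordinates is already within it. *)
  have cX2 : (2 <= #|X|)%N.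
    rewrite ltnNge; apply/negP => cX1; have eX : #|X| = 1%N by lia.
    by move: gt; rewrite eX mul1n; lia.
  lia.
- move=> s x; rewrite big_sumType/= [X in _ + X]big1 ?addr0 => [|j _]; last first.
    by rewrite mul0r.
  rewrite (bigD1 s)//= eqxx mulr1 big1 ?addr0// => s'.
  by rewrite eq_sym => /negbTE ->; rewrite mulr0.
- move=> d d' dd'.
  have dS s : \sum_x d s x = \sum_x d' s x.
    by have := dd' (inl s); rewrite /a !lin_indicator_state.
  split=> //; [move=> y|move=> z|exact: (dd' (inr (inr (inr tt))))].
    by apply: (lin_pmf_last (t0 := y0)) => // y' yy; exact: (dd' (inr (inl (exist _ y' yy)))).
  by apply: (lin_pmf_last (t0 := z0)) => // z' zz;
    exact: (dd' (inr (inr (inl (exist _ z' zz))))).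
Qed.

End Coordinates.

Lemma log2E (x : R) : log2 x = ln x / ln 2.
Proof. by rewrite /log2 RdivE. Qed.

(** I(A;B) = H(A) + H(B) - H(A,B), with ln 2 converting nats to bits. *)
Lemma MI_eta (A B : finType) (p : A -> B -> R) : (forall a b, 0 <= p a b) ->
  MI p = (\sum_a eta (\sum_b p a b) + \sum_b eta (\sum_a p a b)
          - \sum_a \sum_b eta (p a b)) / ln 2.
Proof.
move=> p0.
have pa_ge a b : p a b <= \sum_b p a b by apply: (ler_sumr_term (F := p a)).
have pb_ge a b : p a b <= \sum_a p a b.
  by apply: (ler_sumr_term (F := fun a => p a b)).
have term a b : p a b * log2 (p a b / ((\sum_b p a b) * (\sum_a p a b)))
    = (p a b * - ln (\sum_b p a b) + p a b * - ln (\sum_a p a b) - eta (p a b)) / ln 2.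
  have := p0 a b; rewrite le_eqVlt => /predU1P[<-|pab].
    by rewrite eta0 !mul0r addr0 subrr mul0r.
  have pa : 0 < \sum_b p a b := lt_le_trans pab (pa_ge a b).
  have pb : 0 < \sum_a p a b := lt_le_trans pab (pb_ge a b).
  rewrite log2E lnM ?invr_gt0 ?mulr_gt0// lnV ?mulr_gt0// lnM// /eta.
  by rewrite mulrA; congr (_ / _); ring.
transitivity (\sum_a \sum_b (p a b * - ln (\sum_b p a b) + p a b * - ln (\sum_a p a b)
    - eta (p a b)) / ln 2).
  by apply: eq_bigr => a _; apply: eq_bigr => b _; exact: term.
under eq_bigr do rewrite -mulr_suml sumrB big_split/= -mulr_suml.
rewrite -mulr_suml sumrB big_split/=; congr ((_ + _ - _) / _).
  by apply: eq_bigr => a _; rewrite /eta mulrN.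
rewrite exchange_big; apply: eq_bigr => b _ /=.
by rewrite -mulr_suml /eta mulrN.
Qed.

Section Evaluation.
Variables (S X Y Z : finType) (PS : S -> R) (W : S -> X -> Y -> Z -> R).
Variable x0 : X.
Hypothesis PS_pmf : is_pmf PS.
Hypothesis W_pmf : forall s x, is_pmf (fun yz : Y * Z => W s x yz.1 yz.2).

Lemma WY_ge0 s x y : 0 <= WY W s x y.
Proof.
by apply: sumr_ge0 => z _; apply/RleP; have [h _] := W_pmf s x; exact: (h (y, z)).
Qed.

Lemma WZ_ge0 s x z : 0 <= WZ W s x z.
Proof.
by apply: sumr_ge0 => y _; apply/RleP; have [h _] := W_pmf s x; exact: (h (y, z)).
Qed.

Lemma WY_sum1 s x : \sum_y WY W s x y = 1.
Proof. by have [_ h] := W_pmf s x; rewrite -[RHS]h /sumR sumr_pair. Qed.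

Lemma WZ_sum1 s x : \sum_z WZ W s x z = 1.
Proof. by rewrite exchange_big; exact: WY_sum1. Qed.

Lemma PS_ge0 s : 0 <= PS s.
Proof. by apply/RleP; case: PS_pmf. Qed.

Lemma PS_sum1 : \sum_s PS s = 1.
Proof. by case: PS_pmf. Qed.

(** Determinism lets each slice be written as a state mass times the indicator of x = [xf t s]. In
    the difference of the two mutual informations H(U) cancels, leaving exactly the [phi]
    expression. *)
Lemma scheme_value N (D : 'I_N -> S -> X -> R) :
  (forall t s x, 0 <= D t s x) -> deterministic D ->
  (forall s, \sum_x \sum_t D t s x = PS s) ->
  exists (PUS : S -> 'I_N -> R) (xf : 'I_N -> S -> X),
    [/\ forall s, is_pmf (PUS s),
       forall a : S -> X -> R,
         \sum_s \sum_u PS s * PUS s u * a s (xf u s) = \sum_t lin a (D t)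
     & nc_value PS W PUS xf
       = (\sum_t phi (WY W) (D t) - phi (WY W) (fun s x => \sum_t D t s x)) / ln 2].
Proof.
move=> D0 Ddet DPS; pose J t s := \sum_x D t s x.
have J0 t s : 0 <= J t s by apply: sumr_ge0.
have JPS s : \sum_t J t s = PS s by rewrite -DPS exchange_big.
(* The alphabet is nonempty because [PS] has mass 1; [t0] is the default letter of [PUS] at states
   of probability zero. *)
have [t0 _] : exists t : 'I_N, true.
  have [||s Ps] := sumr_gt0_neq0 (F := PS); [exact: PS_ge0|by rewrite PS_sum1|].
  have [||t _] := sumr_gt0_neq0 (F := J^~ s); [by []|by rewrite JPS|by exists t].
pose xf t s := odflt x0 [pick x | D t s x != 0].
have Dxf t s x : D t s x = J t s * (x == xf t s)%:R.
  rewrite /J /xf; case: pickP => [x1 /= Dx1|Dx]; last first.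
    rewrite big1; last by move=> x' _; apply/eqP; move: (Dx x') => /negbFE.
    by rewrite mul0r; apply/eqP; move: (Dx x) => /negbFE.
  have D1 x' : x' != x1 -> D t s x' = 0.
    by move=> xx; have /eqP := Ddet t s x' x1 xx; rewrite mulf_eq0 (negbTE Dx1) orbF => /eqP.
  rewrite (bigD1 x1)//= big1 ?addr0//.
  by case: (eqVneq x x1) => [->|/D1 ->]; rewrite ?mulr1 ?mulr0.
pose PUS s t := if PS s == 0 then (t == t0)%:R else J t s / PS s.
have PUSJ s t : PS s * PUS s t = J t s.
  rewrite /PUS; case: (eqVneq (PS s) 0) => [Ps|Ps]; last by rewrite mulrC divfK.
  rewrite Ps mul0r; apply/eqP; rewrite eq_le J0 -Ps -JPS.
  by rewrite (ler_sumr_term (F := J^~ s)).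
have lin_xf (a : S -> X -> R) t : lin a (D t) = \sum_s J t s * a s (xf t s).
  apply: eq_bigr => s _; rewrite (bigD1 (xf t s))//= Dxf eqxx mulr1 big1 ?addr0//.
  by move=> x /negbTE xt; rewrite Dxf xt mulr0 mul0r.
exists PUS, xf; split.
- move=> s; split.
    move=> t; apply/RleP; rewrite /PUS; case: ifP => _; first exact: ler0n.
    by rewrite divr_ge0// PS_ge0.
  suff : \sum_t PUS s t = 1 by [].
  rewrite /PUS; case: (eqVneq (PS s) 0) => Ps; last by rewrite -mulr_suml JPS divff.
  by rewrite (bigD1 t0)//= eqxx big1 ?addr0// => t /negbTE ->.
- move=> a; rewrite exchange_big; apply: eq_bigr => t _ /=.
  by rewrite lin_xf; apply: eq_bigr => s _; rewrite PUSJ.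
have out u y : \sum_s PS s * PUS s u * WY W s (xf u s) y
    = lin (fun s x => WY W s x y) (D u).
  by rewrite lin_xf; apply: eq_bigr => s _; rewrite PUSJ.
rewrite /nc_value RminusE !MI_eta; first last.
- by move=> u y; have := lin_ge0 (fun s x => WY_ge0 s x y) (D0 u); rewrite -out.
- by move=> u s; have := J0 u s; rewrite -PUSJ.
rewrite -mulrBl; congr (_ / _).
have -> : \sum_u eta (\sum_y sumR (fun s => PS s * PUS s u * WY W s (xf u s) y))
    = \sum_u eta (\sum_s PS s * PUS s u).
  apply: eq_bigr => u _; congr eta.
  transitivity (\sum_y lin (fun s x => WY W s x y) (D u)).
    by apply: eq_bigr => y _; exact: out.
  rewrite (sum_lin_pmf WY_sum1); apply: eq_bigr => s _.
  by rewrite PUSJ.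
have -> : \sum_y eta (\sum_u sumR (fun s => PS s * PUS s u * WY W s (xf u s) y))
    = \sum_y eta (lin (fun s x => WY W s x y) (fun s x => \sum_t D t s x)).
  apply: eq_bigr => y _; congr eta; rewrite lin_sum.
  by apply: eq_bigr => u _; exact: out.
have -> : \sum_s eta (\sum_u PS s * PUS s u) = \sum_s eta (\sum_x \sum_t D t s x).
  apply: eq_bigr => s _; congr eta; rewrite DPS -[RHS]JPS.
  by apply: eq_bigr => u _; exact: PUSJ.
have -> : \sum_u \sum_y eta (sumR (fun s => PS s * PUS s u * WY W s (xf u s) y))
    = \sum_u \sum_y eta (lin (fun s x => WY W s x y) (D u)).
  by apply: eq_bigr => u _; apply: eq_bigr => y _; congr eta; exact: out.
have -> : \sum_u \sum_s eta (PS s * PUS s u) = \sum_u \sum_s eta (J u s).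
  by apply: eq_bigr => u _; apply: eq_bigr => s _; rewrite PUSJ.
rewrite /phi sumrB /J; ring.
Qed.

End Evaluation.

(** * Codes *)

Section Code.
Variables (S X Y Z : finType) (PS : S -> R) (W : S -> X -> Y -> Z -> R).
Variables (x0 : X) (b : X -> R).
Hypothesis PS_pmf : is_pmf PS.
Hypothesis W_pmf : forall s x, is_pmf (fun yz : Y * Z => W s x yz.1 yz.2).
Hypothesis Q0_gt0 : forall z, 0 < Q0 PS W x0 z.

Lemma Q0_sum1 : \sum_z Q0 PS W x0 z = 1.
Proof.
rewrite exchange_big -[RHS](PS_sum1 PS_pmf); apply: eq_bigr => s _.
by rewrite -mulr_sumr (WZ_sum1 W_pmf) mulr1.
Qed.

Variables (n Mn Kn : nat) (C : nc_code S X Y n Mn Kn).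
Hypotheses (n0 : (0 < n)%N) (M0 : (0 < Mn)%N) (K0 : (0 < Kn)%N).

Let Om : finType := ('I_Mn * 'I_Kn * {ffun 'I_n -> S} * {ffun 'I_n -> X})%type.
Let wt (c : Om) := cweight PS C c.1.1.1 c.1.1.2 c.1.2 c.2.
Let mk (c : Om) := c.1.1.
Let sv (c : Om) := c.1.2.
Let xv (c : Om) := c.2.

Lemma sum_code (F : Om -> R) :
  \sum_c F c = \sum_m \sum_k \sum_s \sum_x F (m, k, s, x).
Proof. by rewrite !sumr_pair. Qed.

Lemma enc_ge0 m k s x : 0 <= enc C m k s x.
Proof. by apply/RleP; case: (enc_pmf C m k s). Qed.

Lemma enc_sum1 m k s : \sum_x enc C m k s x = 1.
Proof. by case: (enc_pmf C m k s). Qed.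

Lemma cweightE m k s x :
  cweight PS C m k s x = (Mn%:R * Kn%:R)^-1 * (\prod_j PS (s j)) * enc C m k s x.
Proof. by rewrite /cweight !INRE invfM. Qed.

Lemma code_weight_ge0 c : 0 <= wt c.
Proof.
rewrite /wt cweightE mulr_ge0 ?enc_ge0// mulr_ge0 ?invr_ge0 ?mulr_ge0 ?ler0n//.
by apply: prodr_ge0 => j _; exact: PS_ge0.
Qed.

Lemma code_weight_state (F : 'I_Mn * 'I_Kn -> {ffun 'I_n -> S} -> R) :
  \sum_c wt c * F (mk c) (sv c) = (#|'I_Mn|%:R * #|'I_Kn|%:R)^-1
    * \sum_d \sum_(s : {ffun 'I_n -> S}) (\prod_j PS (s j)) * F d s.
Proof.
rewrite !card_ord sum_code [in RHS]sumr_pair mulr_sumr; apply: eq_bigr => m _.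
rewrite mulr_sumr; apply: eq_bigr => k _.
rewrite mulr_sumr; apply: eq_bigr => s _.
rewrite /wt /mk /sv /=; under eq_bigr do rewrite cweightE mulrAC.
by rewrite -mulr_sumr enc_sum1 mulr1 mulrA.
Qed.

Lemma code_weight_sum1 : \sum_c wt c = 1.
Proof.
have := code_weight_state (fun _ _ => 1).
rewrite -mulr_suml mulr1 => ->.
have -> : \sum_(d : 'I_Mn * 'I_Kn) \sum_(s : {ffun 'I_n -> S}) (\prod_j PS (s j)) * 1
    = \sum_(d : 'I_Mn * 'I_Kn) 1.
  apply: eq_bigr => d _; rewrite -mulr_suml mulr1.
  by rewrite (sum_prod_pmf (V := fun _ => PS))// => _; exact: PS_sum1.
rewrite sumr_const card_prod natrM mulVf// mulf_neq0//.
  by rewrite card_ord pnatr_eq0 -lt0n.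
by rewrite card_ord pnatr_eq0 -lt0n.
Qed.

Lemma code_error_prob : error_prob (WY W) wt mk sv xv (dec C) = Pe PS W C.
Proof.
rewrite /error_prob sumr_pair sum_code.
do 4![apply: eq_bigr => ? _]; apply: eq_bigr => y _; rewrite /joint /wt /=.
by rewrite eq_sym; case: eqP.
Qed.

Lemma Pe_ge0 : 0 <= Pe PS W C.
Proof.
rewrite -code_error_prob; apply: sumr_ge0 => w _.
rewrite mulr_ge0 ?ler0n//; apply: joint_ge0; first exact: WY_ge0.
exact: code_weight_ge0.
Qed.

Lemma code_cost :
  n%:R^-1 * \sum_(i < n) \sum_c wt c * b (xv c i) = Ecost PS C b.
Proof.
rewrite exchange_big mulr_sumr sum_code; do 4![apply: eq_bigr => ? _] => /=.
by rewrite -mulr_sumr RdivE INRE /wt /xv /= mulrCA [in RHS]mulrC mulrC.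
Qed.

Lemma PZhat_sum (F : {ffun 'I_n -> Z} -> R) :
  \sum_z PZhat PS W C z * F z = \sum_c wt c *
    \sum_(z : {ffun 'I_n -> Z}) (\prod_i WZ W (sv c i) (xv c i) (z i)) * F z.
Proof.
have PZE z : PZhat PS W C z = \sum_c wt c * \prod_i WZ W (sv c i) (xv c i) (z i).
  by rewrite sum_code.
under eq_bigr do rewrite PZE mulr_suml.
rewrite exchange_big; apply: eq_bigr => c _ /=.
by rewrite mulr_sumr; apply: eq_bigr => z _; rewrite mulrA.
Qed.

Lemma warden_marginal i z :
  \sum_zn PZhat PS W C zn * (zn i == z)%:R = \sum_c wt c * WZ W (sv c i) (xv c i) z.
Proof.
rewrite PZhat_sum; apply: eq_bigr => c _; congr (_ * _).
have V1 j : \sum_a WZ W (sv c j) (xv c j) a = 1 by exact: WZ_sum1.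
have := @resample _ _ _ V1 xpredT i z (fun _ _ _ => erefl).
rewrite /= (sum_prod_pmf V1) mulr1 => <-; rewrite [RHS]big_mkcond.
by apply: eq_bigr => zn _ /=; case: eqP; rewrite ?mulr1 ?mulr0.
Qed.

Lemma Q0n_marginal i z :
  \sum_(zn : {ffun 'I_n -> Z}) Q0n PS W x0 zn * (zn i == z)%:R = Q0 PS W x0 z.
Proof.
have := @resample 'I_n _ (fun _ => Q0 PS W x0) (fun _ => Q0_sum1) xpredT i z
  (fun _ _ _ => erefl).
rewrite /= (sum_prod_pmf (V := fun _ => Q0 PS W x0)) ?mulr1 => [<-|_]; last exact: Q0_sum1.
rewrite [RHS]big_mkcond; apply: eq_bigr => zn _ /=.
by case: eqP; rewrite ?mulr1 ?mulr0.
Qed.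

Definition warden_dist : R := \sum_zn `|PZhat PS W C zn - Q0n PS W x0 zn|.

Lemma warden_dist_KL delta : 0 <= delta <= 1 / 2 ->
  delta * warden_dist <= KL (PZhat PS W C) (Q0n PS W x0 (n := n)) + 2 * delta ^+ 2.
Proof.
apply: KL_ge_dist.
- move=> z; have -> : PZhat PS W C z = \sum_c wt c * \prod_i WZ W (sv c i) (xv c i) (z i).
    by rewrite sum_code.
  apply: sumr_ge0 => c _; rewrite mulr_ge0 ?code_weight_ge0// prodr_ge0// => i _.
  exact: WZ_ge0.
- have := PZhat_sum (fun=> 1); rewrite -mulr_suml mulr1 => ->.
  rewrite -[RHS]code_weight_sum1; apply: eq_bigr => c _.
  rewrite -mulr_suml (sum_prod_pmf (V := fun i => WZ W (sv c i) (xv c i))) ?mulr1//.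
  by move=> j; exact: WZ_sum1.
- by move=> z; apply: prodr_gt0.
- by apply: (sum_prod_pmf (V := fun _ => Q0 PS W x0)) => _; exact: Q0_sum1.
Qed.

(** Projecting to one coordinate does not increase the L1 distance, nor does averaging over time; so
    the distance of the n-letter laws bounds that of the averaged letter, with no factor n. *)
Lemma avg_warden_marginal z :
  `|n%:R^-1 * (\sum_(i < n) \sum_c wt c * WZ W (sv c i) (xv c i) z) - Q0 PS W x0 z|
  <= warden_dist.
Proof.
have n0R : 0 < n%:R :> R by rewrite ltr0n.
have -> : Q0 PS W x0 z = n%:R^-1 * \sum_(i < n) Q0 PS W x0 z.
  by rewrite sumr_const card_ord -[X in _ * X]mulr_natl mulKf// gt_eqF.
rewrite -mulrBr -sumrB normrM ger0_norm ?invr_ge0 ?ler0n// ler_pdivrMl//.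
apply: le_trans (ler_norm_sum _ _ _) _.
have -> : n%:R * warden_dist = \sum_(i < n) warden_dist.
  by rewrite sumr_const card_ord -[RHS]mulr_natl.
apply: ler_sum => i _; rewrite -warden_marginal -(Q0n_marginal i) -sumrB.
apply: le_trans (ler_norm_sum _ _ _) _; apply: ler_sum => zn _.
rewrite -mulrBl normrM; case: eqP => _; rewrite ?normr1 ?mulr1// normr0 mulr0.
exact: normr_ge0.
Qed.

(** The alphabet ['I_#|J|] is the same for all block lengths, so the schemes of successive codes lie
    in one compact set. *)
Lemma code_scheme_bound (J : finType) (a : J -> S -> X -> R) (c : J -> R) :
  (forall s x, \sum_j c j * a j s x = 1) ->
  (forall d d', (forall j, lin (a j) d = lin (a j) d') ->
     same_marginals (WY W) (WZ W) b d d') ->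
  exists D : 'I_#|J| -> S -> X -> R,
    [/\ forall t s x, 0 <= D t s x, deterministic D,
       forall s, \sum_x \sum_t D t s x = PS s
     & [/\ \sum_t lin (fun _ => b) (D t) = Ecost PS C b,
       forall z, `|\sum_t lin (fun s x => WZ W s x z) (D t) - Q0 PS W x0 z| <= warden_dist
     & ln Mn%:R - Pe PS W C * ln Mn%:R - ln 2
       <= n%:R * (\sum_t phi (WY W) (D t)
                  - phi (WY W) (fun s x => \sum_t D t s x))]].
Proof.
move=> ac aP.
have M0' : (0 < #|'I_Mn|)%N by rewrite card_ord.
have K0' : (0 < #|'I_Kn|)%N by rewrite card_ord.
have [T [D1 [D1_ge0 D1lin D1S]]] := code_converse (PS_ge0 PS_pmf) (PS_sum1 PS_pmf)
  (WY_ge0 W_pmf) (WY_sum1 W_pmf) xv (dec C) code_weight_ge0 code_weight_sum1 n0 M0' K0'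
  code_weight_state.
rewrite code_error_prob card_ord => D1phi.
have [D2 [D2_ge0 D2det D2agg D2phi]] :=
  functional_representation (WY_ge0 W_pmf) (WY_sum1 W_pmf) x0 D1_ge0.
have [D3 [D3_ge0 D3det D3lin D3phi]] :=
  scheme_support_reduction (WY_ge0 W_pmf) (WY_sum1 W_pmf) ac D2_ge0 D2det.
have [mS mY mZ mb] : same_marginals (WY W) (WZ W) b
    (fun s x => \sum_t D3 t s x) (fun s x => \sum_t D1 t s x).
  apply: aP => j; rewrite lin_sum D3lin -lin_sum; exact: eq_lin.
exists D3; split=> //; first by move=> s; rewrite mS D1S.
split.
- by rewrite -lin_sum mb lin_sum D1lin code_cost.
- by move=> z; rewrite -lin_sum mZ lin_sum D1lin avg_warden_marginal.
- apply: le_trans D1phi _; rewrite ler_pM2l ?ltr0n//.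
  have -> : phi (WY W) (fun s x => \sum_t D3 t s x) = phi (WY W) (fun s x => \sum_t D1 t s x).
    congr (_ - _); first by apply: eq_bigr => s _; rewrite mS.
    by apply: eq_bigr => y _; rewrite mY.
  by rewrite lerD2r (le_trans D2phi).
Qed.

End Code.

Lemma msize_bounds (r : R) n : 0 <= r ->
  [/\ (0 < msize r n)%N, ln (msize r n)%:R <= n%:R * r * ln 2
    & n%:R * r * ln 2 - ln 2 <= ln (msize r n)%:R].
Proof.
move=> r0; pose e := Rpower 2 (INR n * r).
have eE : ln e = n%:R * r * ln 2 by rewrite /e /Rpower ln_exp INRE.
have e1 : 1 <= e.
  have := exp_ineq1_le (Rmult (INR n * r) (ln 2)) => /RleP; apply: le_trans.
  by rewrite RplusE R1E lerDl !mulr_ge0 ?(ltW ln2_gt0)// INRE ler0n.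
have [/RleP ip1 /RltP ip2] := base_Int_part e.
have ip2' : e - 1 < IZR (Int_part e) by move: ip2; rewrite RminusE (_ : IZR (-1) = -1)//; lra.
have ip0 : Z.lt Z0 (Int_part e).
  by apply: lt_IZR; apply/RltP; apply: le_lt_trans ip2'; rewrite subr_ge0.
have ME : (msize r n)%:R = IZR (Int_part e).
  rewrite -INRE /msize -/e INR_IZR_INZ Z2Nat.id//; exact: Z.lt_le_incl.
have ip1' : 1 <= IZR (Int_part e).
  by apply/RleP; apply: IZR_le; lia.
have Mpos : 0 < (msize r n)%:R :> R by rewrite ME; exact: lt_le_trans ltr01 ip1'.
split.
- by move: Mpos; rewrite ltr0n.
- by rewrite -eE ler_ln// ME.
(* As the integer part of e is at least 1, e is at most twice it: rounding costs ln 2. *)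
- have : ln e <= ln (2 * (msize r n)%:R).
    apply: ler_ln; first exact: lt_le_trans ltr01 e1.
    by rewrite ME; lra.
  by rewrite eE lnM//; lra.
Qed.

Lemma Un_cv_le_eventually (u : nat -> R) (l B : R) : Un_cv u l ->
  (forall e, 0 < e -> exists N, forall n, (N <= n)%N -> u n <= B + e) -> l <= B.
Proof.
move=> /Un_cvP ul uB; rewrite leNgt; apply/negP => Bl.
pose e := (l - B) / 2; have e0 : 0 < e by rewrite divr_gt0// subr_gt0.
have [N1 h1] := ul e e0; have [N2 h2] := uB e e0.
have := h1 (maxn N1 N2) (leq_maxl _ _); have := h2 (maxn N1 N2) (leq_maxr _ _).
rewrite ltr_norml => h3 /andP[h4 _].
have : l - B = e + e by rewrite /e; field.
lra.
Qed.

Lemma limit_scheme (S X Y Z : finType) (PS : S -> R) (W : S -> X -> Y -> Z -> R)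
    (x0 : X) (b : X -> R) (RK B r : R) :
  is_pmf PS -> (forall s x, is_pmf (fun yz : Y * Z => W s x yz.1 yz.2)) ->
  (forall z, 0 < Q0 PS W x0 z) -> 0 <= RK -> achievable_nc PS W x0 b RK B r ->
  exists (N : nat) (D : 'I_N -> S -> X -> R),
    [/\ (N <= minn (#|X| + #|Y| + #|Z| + #|S| - 3) (#|X| * #|S|))%N,
       (forall t s x, 0 <= D t s x) /\ deterministic D,
       forall s, \sum_x \sum_t D t s x = PS s
     & [/\ forall z, \sum_t lin (fun s x => WZ W s x z) (D t) = Q0 PS W x0 z,
        \sum_t lin (fun _ => b) (D t) <= B
      & r * ln 2 <= \sum_t phi (WY W) (D t) - phi (WY W) (fun s x => \sum_t D t s x)]].
Proof.
move=> PS_pmf W_pmf Q0_gt0 RK0 [/RleP r0 [codes [cost [err div]]]].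
have [s0 _] : exists s, 0 < PS s.
  by apply: sumr_gt0_neq0; [exact: PS_ge0|rewrite PS_sum1].
have [y0 _] : exists y, 0 < WY W s0 x0 y.
  by apply: sumr_gt0_neq0; [exact: WY_ge0|rewrite WY_sum1].
have [z0 _] : exists z, 0 < WZ W s0 x0 z.
  by apply: sumr_gt0_neq0; [exact: WZ_ge0|rewrite WZ_sum1].
have [J [a [c [Jle ac aP]]]] :=
  marginal_coordinates b (WY_sum1 W_pmf) (WZ_sum1 W_pmf) x0 y0 z0 s0.
have pos q n : 0 <= q -> (0 < msize q n)%N by move=> q0; case: (msize_bounds n q0).
(* Lengths start at 1, since the averages over time divide by the length. *)
have [D D_P] := choice (fun n => code_scheme_bound x0 PS_pmf W_pmf (codes n.+1)
  (ltn0Sn n) (pos r n.+1 r0) (pos RK n.+1 RK0) ac aP).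
have D0 n t s x : 0 <= D n t s x by case: (D_P n).
have D01 n t s x : 0 <= D n t s x <= 1.
  rewrite D0 -(PS_sum1 PS_pmf); case: (D_P n) => _ _ DS _.
  apply: le_trans (ler_sumr_term s (PS_ge0 PS_pmf)); rewrite -DS.
  apply: le_trans (ler_sumr_term (F := fun x => \sum_t D n t s x) x _).
    by apply: (ler_sumr_term (F := fun t => D n t s x)).
  by move=> x'; apply: sumr_ge0.
have [|h [D' [hn D'0 D'det D'cv]]] := scheme_limit D01; first by move=> n; case: (D_P n).
have agg_cv s x : Un_cv (fun n => \sum_t D (h n) t s x) (\sum_t D' t s x).
  exact: Un_cv_sum.
have lin_cv (f : S -> X -> R) :
    Un_cv (fun n => \sum_t lin f (D (h n) t)) (\sum_t lin f (D' t)).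
  by apply: Un_cv_sum => t; exact: Un_cv_lin.
have hnS n N : (N <= n)%N -> (N <= (h n).+1)%N.
  by move=> Nn; apply: leqW; exact: leq_trans (hn n).
have err' : Un_cv (fun n => Pe PS W (codes (h n).+1)) 0.
  by apply: (Un_cv_subseq (h := fun n => (h n).+1)) err => n; exact: hnS.
exists #|J|, D'; split=> //.
- move=> s; apply: UL_sequence (Un_cv_sum (agg_cv s)) _.
  apply: Un_cv_ext (Un_cv_cst (PS s)) => n.
  by case: (D_P (h n)) => _ _ ->.
split.
- move=> z; apply/eqP; rewrite -subr_eq0 -normr_le0.
  apply: (Un_cv_le_eventually
    (u := fun n => `|\sum_t lin (fun s x => WZ W s x z) (D (h n) t) - Q0 PS W x0 z|)).
    apply: cv_cvabs; exact: CV_minus (lin_cv _) (Un_cv_cst _).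
  move=> e e0; rewrite add0r.
  (* With [delta] at most e/4 the quadratic error 2 [delta]^2 is at most [delta] e/2; once the
     divergence is below [delta] e/2 too, dividing by [delta] bounds the distance by e. *)
  have [delta [d0 d1 de]] : exists delta : R, [/\ 0 < delta, delta <= 1 / 2 & delta <= e / 4].
    exists (Num.min (1 / 2) (e / 4)).
    by rewrite lt_min !divr_gt0// ge_min lexx ge_min lexx orbT.
  move/Un_cvP: div => /(_ (delta * (e / 2))) [|N divN].
    by rewrite mulr_gt0// divr_gt0.
  exists N => n Nn; case: (D_P (h n)) => _ _ _ [_ /(_ z) /le_trans + _]; apply.
  rewrite -(ler_pM2l d0); have := divN _ (hnS n N Nn); rewrite subr0.
  have := warden_dist_KL PS_pmf W_pmf Q0_gt0 (codes (h n).+1)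
    (pos r (h n).+1 r0) (pos RK (h n).+1 RK0) (delta := delta).
  rewrite (ltW d0) d1 => /(_ isT) h1 h2.
  have h3 := le_lt_trans (ler_norm _) h2.
  have h4 : delta * delta <= delta * (e / 4) by rewrite ler_pM2l.
  rewrite expr2 in h1; lra.
- apply: (Un_cv_le_eventually (lin_cv (fun _ => b))) => e /RltP e0.
  have [N costN] := cost e e0; exists N => n Nn.
  case: (D_P (h n)) => _ _ _ [-> _ _]; apply/RleP/costN.
  by apply/ssrnat.leP; exact: hnS.
(* One ln 2 is lost to Fano's inequality and one to the rounding of the message set; both vanish
   after division by the length. The error term uses the upper bound on ln |M|. *)
- pose low n := r * ln 2 - 2 * ln 2 * (h n).+1%:R^-1 - Pe PS W (codes (h n).+1) * (r * ln 2).
  have inv_cv : Un_cv (fun n => (h n).+1%:R^-1) 0.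
    apply: (Un_cv_subseq (h := h) (u := fun n => n.+1%:R^-1)) => //.
    apply/Un_cvP => e e0; exists (Num.bound e^-1) => n Nn.
    rewrite subr0 ger0_norm ?invr_ge0 ?ler0n// invf_plt ?posrE// ?ltr0n//.
    apply: lt_le_trans (archi_boundP _) _; first by rewrite invr_ge0 ltW.
    by rewrite ler_nat; exact: leqW.
  have low_cv : Un_cv low (r * ln 2).
    have := CV_minus _ _ _ _ (CV_minus _ _ _ _ (Un_cv_cst (r * ln 2))
      (CV_mult _ _ _ _ (Un_cv_cst (2 * ln 2)) inv_cv))
      (CV_mult _ _ _ _ err' (Un_cv_cst (r * ln 2))).
    by rewrite !RminusE !RmultE mulr0 mul0r !subr0.
  apply: Un_cv_le low_cv (CV_minus _ _ _ _ (Un_cv_sum (fun t =>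
    Un_cv_phi (WY_ge0 W_pmf) (D'cv t) (fun n => D0 (h n) t)))
    (Un_cv_phi (WY_ge0 W_pmf) agg_cv _)); last first.
    by move=> n s x; apply: sumr_ge0.
  move=> n; case: (D_P (h n)) => _ _ _ [_ _].
  set gap := _ - phi _ _; rewrite RminusE -/gap.
  set m := (h n).+1; have m0 : 0 < m%:R :> R by rewrite ltr0n.
  have [_ up lo] := msize_bounds m r0.
  have := ler_wpM2l (Pe_ge0 PS_pmf W_pmf (codes m)) up => up' bound.
  rewrite -(ler_pM2l m0) /low -/m.
  have -> : m%:R * (r * ln 2 - 2 * ln 2 * m%:R^-1 - Pe PS W (codes m) * (r * ln 2))
      = m%:R * r * ln 2 - 2 * ln 2 - Pe PS W (codes m) * (m%:R * r * ln 2).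
    by field; rewrite gt_eqF.
  lra.
Qed.

(* The single-letter bound on achievable rates *)
Close Scope ring_scope.
Delimit Scope R_scope with R.

Theorem theorem3 (S X Y Z : finType) (PS : S -> R) (W : S -> X -> Y -> Z -> R)
  (x0 : X) (b : X -> R) (RK B : R) :
  is_pmf PS ->
  (forall s x, is_pmf (fun yz : Y * Z => W s x yz.1 yz.2)) ->
  (forall z, (0 < Q0 PS W x0 z)%R) ->
  (forall x, (0 <= b x)%R) ->
  (0 <= RK)%R -> (0 <= B)%R ->
  forall r : R, achievable_nc PS W x0 b RK B r ->
  exists (U : finType) (PUS : S -> U -> R) (xf : U -> S -> X),
    (#|U| <= minn (#|X| + #|Y| + #|Z| + #|S| - 3) (#|X| * #|S|))%N /\
    nc_feasible PS W x0 b B PUS xf /\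
    (r <= nc_value PS W PUS xf)%R.
Proof.
move=> PS_pmf W_pmf Q0_gt0 _ /RleP RK0 _ r ach.
have [N [D [NX [D0 Ddet] DS [DZ Db Dr]]]] :=
  limit_scheme PS_pmf W_pmf (fun z => introT RltP (Q0_gt0 z)) RK0 ach.
have [PUS [xf [PUS_pmf PUSlin val]]] := scheme_value x0 PS_pmf W_pmf D0 Ddet DS.
exists 'I_N, PUS, xf; rewrite card_ord; split=> //; split; [split=> //; split|].
- by move=> z; rewrite -DZ -PUSlin.
- by apply/RleP; move: Db; rewrite -PUSlin.
- by apply/RleP; rewrite val ler_pdivlMr ?ln2_gt0.
Qed.
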